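(* Let $\delta\in[\frac12,1]$ and let $(u,v)$ satisfy the boundary conditions and the divergence-free condition of the context. There exists $\delta'>0$ such that if $q=1+\delta'$, then $$\|u_R\|_{L^4_{*,2+\frac{2\alpha}q}}\lesssim\|u\|_X^{\frac12}\|u\|_{\dot H^2_{*,2+\delta}}^{\frac12}\qquad\text{and}\qquad\|v_R\|_{L^4_{*,2+\frac{2\alpha}q}}\lesssim\|v\|_X^{\frac12}\|v\|_{\dot H^2_{*,2+\delta}}^{\frac12}$$ for all $0\le\alpha\le\frac{q\delta}2$. Moreover, by taking $\delta'$ small enough, $\alpha$ can be selected such that $\frac qp=\frac{1+\delta'}p\le\alpha\le\frac{q\delta}2$, where $p$ is the Hölder conjugate of $q$.
   Context: $R_0>0$, $\theta_0>0$ (small), $0<\varepsilon\le1$. $(\omega,R)\in\Omega=(0,\theta_0)\times(R_0,\infty)$; $r=r(R)=R_0+\sqrt\varepsilon(R-R_0)$; $\iint=\int_0^{\theta_0}\int_{R_0}^\infty\cdot\,dR\,d\omega$. Boundary conditions: $u=v=0$ on $\{\omega=0\}$ and on $\{R=R_0\}$; $\varepsilon v_\omega+ru_R=0$ on $\{\omega=\theta_0\}$ (and, for the associated pressure $P$, $Pr=2\varepsilon u_\omega$ there). Divergence-free condition: $u_\omega+\partial_R(rv)=0$. Norms: $\|h\|_{L^4_{*,\kappa}}=(\iint|h|^4r^\kappa)^{1/4}$; $\|h\|_X^2=\iint(h^2r^\delta+h_\omega^2r^\delta+h_R^2r^{1+\delta})$; $\|h\|_{\dot H^2_{*,2+\delta}}^2=\iint\big(\frac{h_{\omega\omega}^2}{r^4}+\frac{h_{\omega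 R}^2}{r^2}+h_{RR}^2\big)r^{2+\delta}$. The norms on the right-hand sides are assumed finite; implicit constants are independent of $\varepsilon$ and $(u,v)$. *)

(* Defs.v *)
From HB Require Import structures.
From mathcomp Require Import all_boot all_order all_algebra.
From mathcomp Require Import all_classical all_reals all_analysis.
Set Implicit Arguments.
Unset Strict Implicit.
Unset Printing Implicit Defensive.
Import Order.TTheory GRing.Theory Num.Theory.
Import numFieldNormedType.Exports.
Local Open Scope classical_set_scope.
Local Open Scope ring_scope.

(* Points of the plane are pairs z = (omega, R); the radial coordinate R is
   written rho below, the name R being used for the field of real numbers. *)

Section plane.
Context {R : realType}.
Implicit Types (u v w g phi P : R * R -> R) (z : R * R).

Definition plane_measure :
    {measure set (measurableTypeR R * measurableTypeR R) -> \bar R} :=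
  (@lebesgue_measure R \x @lebesgue_measure R)%E.

Definition Omega (theta0 R0 : R) : set (R * R) :=
  `]0, theta0[ `*` `]R0, +oo[.

Definition rcoord (R0 eps rho : R) : R := R0 + Num.sqrt eps * (rho - R0).

Definition partial_omega phi : R * R -> R :=
  fun z => derive1 (fun t : R => phi (t, z.2)) z.1.

Definition partial_rho phi : R * R -> R :=
  fun z => derive1 (fun t : R => phi (z.1, t)) z.2.

Definition partial (i j : nat) phi : R * R -> R :=
  iter i partial_omega (iter j partial_rho phi).

Definition smooth phi : Prop := forall i j : nat,
  [/\ continuous (partial i j phi),
      forall z, derivable (fun t : R => partial i j phi (t, z.2)) z.1 1 &
      forall z, derivable (fun t : R => partial i j phi (z.1, t)) z.2 1].

Definition test_function (theta0 R0 : R) phi : Prop :=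
  smooth phi /\
  exists K : set (R * R), [/\ compact K, K `<=` Omega theta0 R0 &
    forall z, ~ K z -> phi z = 0].

Definition locally_integrable_Omega (theta0 R0 : R) u : Prop :=
  measurable_fun (Omega theta0 R0) u /\
  forall K : set (R * R), compact K -> K `<=` Omega theta0 R0 ->
    (\int[plane_measure]_(z in K) `|u z|%:E < +oo)%E.

Definition is_weak_derivative (theta0 R0 : R) (i j : nat) u g : Prop :=
  [/\ locally_integrable_Omega theta0 R0 u,
      locally_integrable_Omega theta0 R0 g &
      forall phi, test_function theta0 R0 phi ->
        \int[plane_measure]_(z in Omega theta0 R0) (u z * partial i j phi z) =
        (-1) ^+ (i + j) *
        \int[plane_measure]_(z in Omega theta0 R0) (g z * phi z)].

(* The weak derivative is unique up to a null set; a representative is chosen,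
   with junk value 0 when there is none. *)
Definition weak_derivative (theta0 R0 : R) (i j : nat) u : R * R -> R :=
  xget (fun=> 0) [set g | is_weak_derivative theta0 R0 i j u g].

Definition twice_weakly_differentiable (theta0 R0 : R) u : Prop :=
  forall i j : nat, (i + j <= 2)%N ->
    exists g, is_weak_derivative theta0 R0 i j u g.

(* Functions are given up to null sets, so boundary values are traces: w has
   trace zero on a portion of the boundary if the averages of |w| over the
   strips S h of width h along that portion tend to 0.  When w is continuous
   up to the boundary this says that w vanishes there. *)
Definition strip_mean_to0 (S : R -> set (R * R)) w : Prop :=
  (fun h : R => h^-1%:E * \int[plane_measure]_(z in S h) `|w z|%:E)%E
    @ 0^'+ --> 0%E.

Definition vanishes_at_omega0 (R0 : R) w : Prop :=
  forall a b : R, R0 < a -> a < b ->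
    strip_mean_to0 (fun h => `]0, h[ `*` `]a, b[) w.

Definition vanishes_at_theta0 (theta0 R0 : R) w : Prop :=
  forall a b : R, R0 < a -> a < b ->
    strip_mean_to0 (fun h => `]theta0 - h, theta0[ `*` `]a, b[) w.

Definition vanishes_at_R0 (theta0 R0 : R) w : Prop :=
  forall a b : R, 0 < a -> a < b -> b < theta0 ->
    strip_mean_to0 (fun h => `]a, b[ `*` `]R0, R0 + h[) w.

(* The pressure P enters only through its own boundary relation: no equation
   links it to (u, v). *)
Definition boundary_conditions (theta0 R0 eps : R) u v P : Prop :=
  let r z := rcoord R0 eps z.2 in
  let d := weak_derivative theta0 R0 in
  [/\ vanishes_at_omega0 R0 u /\ vanishes_at_omega0 R0 v,
      vanishes_at_R0 theta0 R0 u /\ vanishes_at_R0 theta0 R0 v,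
      vanishes_at_theta0 theta0 R0
        (fun z => eps * d 1 0 v z + r z * d 0 1 u z) &
      measurable_fun (Omega theta0 R0) P /\
      vanishes_at_theta0 theta0 R0
        (fun z => P z * r z - 2 * eps * d 1 0 u z)].

Definition divergence_free (theta0 R0 eps : R) u v : Prop :=
  {ae plane_measure, forall z, Omega theta0 R0 z ->
    weak_derivative theta0 R0 1 0 u z +
    weak_derivative theta0 R0 0 1 (fun y => rcoord R0 eps y.2 * v y) z = 0}.

Definition norm_L4 (theta0 R0 eps kappa : R) w : \bar R :=
  ((\int[plane_measure]_(z in Omega theta0 R0)
     (`|w z| ^+ 4 * rcoord R0 eps z.2 `^ kappa)%:E) `^ (4^-1))%E.

Definition norm_X (theta0 R0 eps delta : R) w : \bar R :=
  let r z := rcoord R0 eps z.2 in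
  let d := weak_derivative theta0 R0 in
  ((\int[plane_measure]_(z in Omega theta0 R0)
     (w z ^+ 2 * r z `^ delta
      + d 1 0 w z ^+ 2 * r z `^ delta
      + d 0 1 w z ^+ 2 * r z `^ (1 + delta))%:E) `^ (2^-1))%E.

Definition norm_H2dot (theta0 R0 eps delta : R) w : \bar R :=
  let r z := rcoord R0 eps z.2 in
  let d := weak_derivative theta0 R0 in
  ((\int[plane_measure]_(z in Omega theta0 R0)
     ((d 2 0 w z ^+ 2 / r z ^+ 4
       + d 1 1 w z ^+ 2 / r z ^+ 2
       + d 0 2 w z ^+ 2) * r z `^ (2 + delta))%:E) `^ (2^-1))%E.

End plane.

(* Main.v *)
(** Write [w] for the radial derivative of [u].  As [2 + 2 alpha / q <= 2 + delta],
    it suffices to bound the integral of [w^4 r^(2 + 2 delta)].  For almost every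
    [(omega, R)],
      [w(omega, R) = int_0^omega w_omega]   and   [w(omega, R) = - int_R^oo w_R],
    the first because [u = 0], hence [w = 0], at [omega = 0], the second because
    [w] and [w_R] are integrable enough at infinity.  Hence
      [w^2 r^(1/2 + delta) <= 2 int |w w_omega| r^(1/2 + delta) domega =: F(R)],
      [w^2 r^(3/2 + delta) <= 2 int |w w_R| r^(3/2 + delta) dR =: G(omega)],
    and the integral of the product is at most [(int F) (int G)], which
    Cauchy-Schwarz bounds by [4 (||u||_X ||u||_H2)^2].  The two representations are
    obtained by testing the weak derivatives against products [a(omega) b(R)] only,
    so that mixed partial derivatives of test functions need not be exchanged. *)

Require Import Defs.
From HB Require Import structures.
From mathcomp Require Import all_boot all_order all_algebra.
From mathcomp Require Import all_classical all_reals all_analysis.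
From mathcomp Require Import measurable_realfun ring lra.
Set Implicit Arguments.
Unset Strict Implicit.
Unset Printing Implicit Defensive.
Import Order.TTheory GRing.Theory Num.Theory.
Import numFieldNormedType.Exports.
Local Open Scope classical_set_scope.
Local Open Scope ring_scope.

(** * Smooth functions of one variable *)

Section smooth_functions.
Context {R : realType}.
Implicit Types (f g : R -> R) (p : {poly R}).

(** The representations of w cannot be read off pointwise: derivatives are weak, and the boundary
    condition is a limit of strip means of |u|, not of |w|. The trace is therefore used only after
    the R-derivative has been moved back from w to u, onto the factor b of the test function.

    The exponents 1/2 + delta and 3/2 + delta are the means of the exponent 1 + delta that the norm
    X gives to w^2 and of the exponents delta and 2 + delta that the second-order norm gives to
    w_omega^2 and w_R^2, so that Cauchy-Schwarz returns exactly these norms. In the omega direction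
    the weight is constant along the path of integration; in the R direction it increases, and
    integrating from infinity keeps it on the right side of the inequality.

    The norms do not make w_omega integrable on the unbounded strip, hence the auxiliary weight
    [decay]. The derivative w_R is integrable, but with a bound that degenerates as eps tends to 0;
    it serves only to justify the representation and does not enter the final constant, which
    depends on R0 alone. *)

Definition smooth1 f := forall n x, derivable (derive1n n f) x 1.

(** Induction on the order of derivation stays inside the family [S], so exhibiting a family stable
    under derivation replaces any formula for the n-th derivative. *)
Lemma smooth1_coind (S : (R -> R) -> Prop) :
  (forall f, S f -> exists2 g, S g & forall x : R, is_derive x 1 f (g x)) ->
  forall f, S f -> smooth1 f.
Proof.
move=> S_derive f Sf n; suff [g /S_derive[h _ gh] ->] :
    exists2 g, S g & derive1n n f = g by move=> x; case: (gh x).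
elim: n => [|n [g /S_derive[h Sh gh] fg]]; first by exists f.
exists h => //; rewrite derive1nS fg; apply/funext => x.
by rewrite derive1E; case: (gh x).
Qed.

Lemma smooth1_is_derive f : smooth1 f ->
  forall x : R, is_derive x 1 f ((derive1 f) x).
Proof.
move=> sf x; rewrite derive1E; apply/derivableP; exact: (sf 0%N).
Qed.

Lemma smooth1_continuous f : smooth1 f -> continuous f.
Proof.
move=> sf x; apply/differentiable_continuous/derivable1_diffP; exact: (sf 0%N).
Qed.

Lemma smooth1_derive1 f : smooth1 f -> smooth1 (derive1 f).
Proof. by move=> sf n x; rewrite -derive1Sn; exact: sf. Qed.

Lemma smooth1_derive1n n f : smooth1 f -> smooth1 (derive1n n f).
Proof.
by move=> sf; elim: n => [|n IH]; [exact: sf|rewrite derive1nS; exact: smooth1_derive1].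
Qed.

Lemma is_derive_derive1 f g : (forall x : R, is_derive x 1 f (g x)) -> (derive1 f) = g.
Proof. by move=> fg; apply/funext => x; rewrite derive1E; case: (fg x). Qed.

Lemma smooth1_of_derive f g : (forall x : R, is_derive x 1 f (g x)) ->
  smooth1 g -> smooth1 f.
Proof.
move=> fg sg [|n] x; first by case: (fg x).
by rewrite derive1Sn (is_derive_derive1 fg); exact: sg.
Qed.

(** Products alone are not stable under derivation; by the Leibniz rule their finite sums are. *)
Inductive sum_of_smooth_products : (R -> R) -> Prop :=
| ssp_mul f g : smooth1 f -> smooth1 g ->
    sum_of_smooth_products (fun x => f x * g x)
| ssp_add f g : sum_of_smooth_products f -> sum_of_smooth_products g ->
    sum_of_smooth_products (fun x => f x + g x).

Lemma smooth1M f g : smooth1 f -> smooth1 g -> smooth1 (fun x => f x * g x).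
Proof.
move=> sf sg; apply: (smooth1_coind (S := sum_of_smooth_products)); last first.
  exact: ssp_mul.
move=> h {sf sg}; elim: h / => [{}f {}g sf sg|f1 g1 _ [f' Sf' ff'] _ [g' Sg' gg']].
  exists (fun x => f x * (derive1 g) x + g x * (derive1 f) x).
    exact: (ssp_add (ssp_mul sf (smooth1_derive1 sg)) (ssp_mul sg (smooth1_derive1 sf))).
  move=> x; have := smooth1_is_derive sf x; have := smooth1_is_derive sg x.
  by move=> ? ?; apply: is_deriveM.
exists (fun x => f' x + g' x); first exact: ssp_add.
by move=> x; have := ff' x; have := gg' x => ? ?; exact: is_deriveD.
Qed.

Lemma smooth1_cst (c : R) : smooth1 (fun=> c).
Proof.
apply: (smooth1_coind (S := fun f => exists c, f = fun=> c)); last by exists c.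
move=> _ [{}c ->]; exists (fun=> 0); first by exists 0.
by move=> x; exact: is_derive_cst.
Qed.

Lemma is_derive_affine f (k c : R) (x : R) : smooth1 f ->
  is_derive x 1 (fun x => f (k * x + c)) (k * derive1 f (k * x + c)).
Proof.
move=> sf; have fx := smooth1_is_derive sf (k * x + c).
have kx : is_derive x 1 (fun x => k * x + c) k.
  have := is_deriveD (is_deriveZ k (is_derive_id x 1)) (is_derive_cst c x 1).
  by rewrite addr0 /GRing.scale /= mulr1.
have := is_derive1_comp (f := f) (g := fun x => k * x + c) fx kx.
by rewrite mulrC.
Qed.

(** The scalar [l] in the family below collects the factors [k] produced by the chain rule. *)
Lemma smooth1_affine f (k c : R) : smooth1 f -> smooth1 (fun x => f (k * x + c)).
Proof.
move=> sf; apply: (smooth1_coind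
  (S := fun g => exists l f, smooth1 f /\ g = fun x => l * f (k * x + c))).
  move=> _ [l [h [sh ->]]]; exists (fun x => l * (k * (derive1 h) (k * x + c))).
    exists (l * k), (derive1 h); split; first exact: smooth1_derive1.
    by apply/funext => x; rewrite mulrA.
  by move=> x; have := is_deriveZ l (is_derive_affine k c x sh).
by exists 1, f; split=> //; apply/funext => x; rewrite mul1r.
Qed.

(* [p(1/x) exp(-1/x)] for [x > 0]: this family is stable under derivation. *)
Definition flat_exp p : R -> R :=
  fun x => if 0 < x then p.[x^-1] * expR (- x^-1) else 0.

(** The exponential series dominates its term of degree n + 1. With y = 1/x this bounds each
    monomial of [flat_exp] by a multiple of x. *)
Lemma pow_expRN_le (y : R) n : 0 < y -> y ^+ n * expR (- y) <= n.+1`!%:R / y.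
Proof.
move=> y0; rewrite expRN ler_pdivrMr ?expR_gt0// mulrAC ler_pdivlMr//.
rewrite -exprSr mulrC -ler_pdivrMr ?ltr0n ?fact_gt0//.
by apply: le_trans (expR_ge1Dxn n (ltW y0)); rewrite lerDr.
Qed.

Lemma flat_exp_le p : exists C : R, forall x, `|flat_exp p x| <= C * `|x|.
Proof.
exists (\sum_(i < size p) `|p`_i| * i.+1`!%:R) => x.
rewrite /flat_exp; case: ifPn => [x0|_]; last first.
  by rewrite normr0 mulr_ge0// sumr_ge0// => i _; rewrite mulr_ge0.
rewrite normrM (ger0_norm (expR_ge0 _)) (gtr0_norm x0) horner_coef.
apply: le_trans (ler_wpM2r (expR_ge0 _) (ler_norm_sum _ _ _)) _.
rewrite !big_distrl/=; apply: ler_sum => i _.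
rewrite normrM -!mulrA ler_wpM2l//.
rewrite ger0_norm ?exprn_ge0 ?invr_ge0 ?(ltW x0)//.
have xV0 : 0 < x^-1 by rewrite invr_gt0.
by apply: le_trans (pow_expRN_le i xV0) _; rewrite invrK.
Qed.

Lemma flat_exp_continuous0 p : {for 0, continuous (flat_exp p)}.
Proof.
have [C pC] := flat_exp_le p.
rewrite /prop_for /continuous_at {2}/flat_exp ltxx.
apply/norm_cvg0P; apply: (squeeze_cvgr (f := cst 0) (h := fun x : R => C * `|x|)).
- by near=> x; rewrite normr_ge0 pC.
- exact: cvg_cst.
- rewrite -[X in _ --> X](mulr0 C) -[X in C * X](@normr0 _ R).
  by apply: cvgM; [exact: cvg_cst|apply: cvg_norm; exact: cvg_id].
Unshelve. all: by end_near. Qed.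

(** For x > 0 the product and chain rules give (p - p')(1/x) exp(-1/x) / x^2. At 0, Caratheodory's
    criterion applies with slope [flat_exp (p * 'X)], whose extra factor 1/x cancels the increment
    x; its continuity at 0 is the linear bound [flat_exp_le] for another polynomial. *)
Lemma is_derive_flat_exp p (x : R) :
  is_derive x 1 (flat_exp p) (flat_exp ('X^2 * (p - p^`())) x).
Proof.
have [x0|x0|->] := ltgtP x 0.
- rewrite /flat_exp ltNge ltW//=.
  apply: near_eq_is_derive (is_derive_cst 0 x 1) => //.
  near=> y; rewrite ifN// -leNgt ltW//; near: y; exact: lt_nbhsl.
- rewrite {2}/flat_exp x0.
  have xV : is_derive x 1 (fun x : R => x^-1) (- x ^- 2).
    have := @is_deriveV R id x 1 1 (lt0r_neq0 x0) (is_derive_id x 1).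
    by rewrite /GRing.scale/= mulr1.
  have xVN : is_derive x 1 (fun x : R => - x^-1) (x ^- 2).
    by rewrite -[X in is_derive _ _ _ X]opprK; exact: is_deriveN.
  have px := is_derive1_comp (f := horner p) (is_derive_poly _ _) xV.
  have ex := is_derive1_comp (f := expR) (is_derive_expR _) xVN.
  have := is_deriveM px ex => /(@near_eq_is_derive _ _ _ _ (flat_exp p)) pex.
  apply: (is_derive_eq (pex _)).
    near=> y; rewrite /flat_exp ifT//; near: y; exact: lt_nbhsr.
  by rewrite !hornerE /GRing.scale/= exprVn; ring.
- apply/is_derive1_caratheodory; exists (flat_exp (p * 'X)); split.
  + move=> z; rewrite {2}/flat_exp ltxx !subr0 /flat_exp.
    case: ifPn => [z0|]; last by rewrite mul0r.
    by rewrite !hornerE [_ * z^-1 * _]mulrAC divfK// gt_eqF.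
  + exact: flat_exp_continuous0.
  + by rewrite /flat_exp ltxx.
Unshelve. all: by end_near. Qed.

Lemma smooth1_flat_exp p : smooth1 (flat_exp p).
Proof.
apply: (smooth1_coind (S := fun f => exists p, f = flat_exp p)); last by exists p.
move=> _ [{}p ->]; exists (flat_exp ('X^2 * (p - p^`()))); first by eexists.
exact: is_derive_flat_exp.
Qed.

(* For fixed [a < b] the bumps increase to the indicator of [`]a, b[] as [n] grows,
   so no convolution is needed to approximate indicators. *)
Definition bump (a b : R) (n : nat) : R -> R := fun x =>
  flat_exp 1 (n.+1%:R * x + - (n.+1%:R * a)) *
  flat_exp 1 (- n.+1%:R * x + n.+1%:R * b).

Lemma smooth1_bump a b n : smooth1 (bump a b n).
Proof. by apply: smooth1M; apply: smooth1_affine; exact: smooth1_flat_exp. Qed.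

Lemma bump_out a b n x : ~~ (a < x < b) -> bump a b n x = 0.
Proof.
rewrite /bump /flat_exp -mulrBr mulNr [- _ + _]addrC -mulrBr.
rewrite !pmulr_rgt0 ?ltr0n// !subr_gt0.
by case: ltP => //=; rewrite ?mul0r// => _; case: ltP => //; rewrite mulr0.
Qed.

Lemma bump_ge0 a b n x : 0 <= bump a b n x.
Proof.
by rewrite mulr_ge0// /flat_exp; case: ifP => // _; rewrite hornerE mul1r expR_ge0.
Qed.

Lemma bump_gt0 a b n x : a < x < b -> 0 < bump a b n x.
Proof.
move=> /andP[ax xb]; rewrite /bump /flat_exp -mulrBr mulNr [- _ + _]addrC -mulrBr.
rewrite [0 < _ * (x - a)]pmulr_rgt0 ?ltr0n// [0 < _ * (b - x)]pmulr_rgt0 ?ltr0n//.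
rewrite !subr_gt0 ax xb.
by rewrite !hornerE !mulr_gt0 ?expR_gt0.
Qed.

Lemma flat_exp1_le1 x : flat_exp 1 x <= 1.
Proof.
rewrite /flat_exp; case: ifPn => // x0.
by rewrite hornerE mul1r expR_le1 oppr_le0 invr_ge0 ltW.
Qed.

Lemma flat_exp1_ge0 x : 0 <= flat_exp 1 x.
Proof. by rewrite /flat_exp; case: ifPn => // x0; rewrite hornerE mul1r expR_ge0. Qed.

Lemma bump_le1 a b n x : bump a b n x <= 1.
Proof. by rewrite /bump mulr_ile1// ?flat_exp1_ge0 ?flat_exp1_le1. Qed.

Lemma flat_exp1_cvg (y : R) : 0 < y ->
  flat_exp 1 (n.+1%:R * y) @[n --> \oo] --> (1 : R).
Proof.
move=> y0; rewrite /flat_exp.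
have -> : (fun n : nat => if 0 < n.+1%:R * y then
    (1%R : {poly R}).[(n.+1%:R * y)^-1] * expR (- (n.+1%:R * y)^-1) else 0) =
    (fun n : nat => expR (- (y^-1 * n.+1%:R^-1))).
  by apply/funext => n; rewrite mulr_gt0// hornerE mul1r invfM mulrC.
rewrite -[X in _ --> X]expR0; apply: continuous_cvg; first exact: continuous_expR.
rewrite -[X in _ --> X]oppr0; apply: cvgN; rewrite -[X in _ --> X](mulr0 y^-1).
by apply: cvgM; [exact: cvg_cst|exact: cvg_harmonic].
Qed.

Lemma bump_cvg a b x : bump a b n x @[n --> \oo] --> (\1_`]a, b[ x : R).
Proof.
rewrite indicE; have [|xab] := boolP (x \in `]a, b[%classic); last first.
  rewrite (_ : (fun n => _) = fun=> 0); first exact: cvg_cst.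
  by apply/funext => n; apply: bump_out; apply: contraNN xab; rewrite inE.
rewrite inE /= in_itv/= => /andP[ax xb].
rewrite /bump (_ : (fun n => _) = fun n => flat_exp 1 (n.+1%:R * (x - a)) *
    flat_exp 1 (n.+1%:R * (b - x))); last first.
  by apply/funext => n; congr (flat_exp _ _ * flat_exp _ _); ring.
rewrite -[X in _ --> X]mulr1.
by apply: cvgM; apply: flat_exp1_cvg; rewrite subr_gt0.
Qed.

(** The endpoints are explicit so that supports of products can be located inside Omega. If b < a
    the condition forces f = 0, which lets later statements ignore the order of the endpoints. *)
Definition csupp (a b : R) f := forall x, ~~ (a <= x <= b) -> f x = 0.

Lemma csupp_bump a b n : csupp a b (bump a b n).
Proof.
move=> x xab; apply: bump_out; apply: contraNN xab.
by move=> /andP[/ltW-> /ltW->].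
Qed.

Lemma csupp_derive1 a b f : csupp a b f -> csupp a b (derive1 f).
Proof.
move=> fab x; rewrite negb_and -!ltNge => /orP[xa|bx];
  rewrite derive1E -[RHS](@derive_cst _ R R (0 : R) x 1);
  apply: near_eq_derive; near=> y; apply: fab; rewrite negb_and -!ltNge.
- by apply/orP; left; near: y; exact: lt_nbhsl.
- by apply/orP; right; near: y; exact: lt_nbhsr.
Unshelve. all: by end_near. Qed.

Lemma csupp_bounded a b f : smooth1 f -> csupp a b f ->
  exists2 C : R, 0 <= C & forall x, `|f x| <= C.
Proof.
move=> sf fab; have [ba|ab] := ltP b a.
  exists 0 => // x; rewrite fab ?normr0//; apply/negP => /andP[ax xb].
  by move: (lt_le_trans ba ax); rewrite ltNge xb.
have cf : {within `[a, b], continuous (fun x => `|f x|)}.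
  apply: continuous_subspaceT => x.
  by apply: cvg_norm; exact: smooth1_continuous.
have [c _ fc] := EVT_max ab cf.
exists `|f c| => // x; have [xab|xab] := boolP (a <= x <= b).
  by apply: fc; rewrite in_itv.
by rewrite fab// normr0.
Qed.

Lemma smooth1_measurable f D : smooth1 f -> measurable_fun D f.
Proof.
move=> sf; apply: (@measurable_funS _ _ _ _ setT) => //.
apply: measurable_realfun.continuous_measurable_fun.
exact: smooth1_continuous.
Qed.

Lemma csupp_integrable a b f (D : set R) : measurable D -> smooth1 f -> csupp a b f ->
  (@lebesgue_measure R).-integrable D (EFin \o f).
Proof.
move=> mD sf fab; apply: (@integrableS _ _ _ _ setT) => //.
have := @continuous_compact_integrable R f _ (@segment_compact R a b) .
move=> /(_ _)/(integrable_mkcond _ _).1 H.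
rewrite (_ : EFin \o f = (EFin \o f) \_ `[a, b]).
  apply: H => //; apply: continuous_subspaceT; exact: smooth1_continuous.
apply/funext => x; rewrite patchE; case: ifPn => // /negP xab.
by rewrite /= fab//; apply/negP => xab'; apply: xab; rewrite inE/= in_itv.
Qed.

(** Starting at minus infinity avoids a base point: for f supported between a and b the primitive is
    0 left of a and constant right of b. *)
Definition primitive f : R -> R := fun x =>
  \int[@lebesgue_measure R]_(t in `]-oo, x]) f t.

Lemma is_derive_primitive a b f : smooth1 f -> csupp a b f ->
  forall x : R, is_derive x 1 (primitive f) (f x).
Proof.
move=> sf fab x; have [||||df <-] := @continuous_FTC1 R f -oo%O x (x + 1).
- by rewrite ltrDl.
- by apply: (@csupp_integrable a b).
- by rewrite ltNyr.
- exact: smooth1_continuous.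
by rewrite derive1E; exact: derivableP.
Qed.

Lemma smooth1_primitive a b f : smooth1 f -> csupp a b f -> smooth1 (primitive f).
Proof.
by move=> sf fab; apply: (smooth1_of_derive _ sf); exact: is_derive_primitive fab.
Qed.

Lemma derive1_primitive a b f : smooth1 f -> csupp a b f -> derive1 (primitive f) = f.
Proof. by move=> sf fab; apply: is_derive_derive1; exact: is_derive_primitive fab. Qed.

Lemma primitive_eq0 f x : (forall t, t <= x -> f t = 0) -> primitive f x = 0.
Proof.
move=> f0; rewrite /primitive (@eq_Rintegral _ _ _ _ _ (cst 0)).
  by rewrite /Rintegral integral0.
by move=> t; rewrite inE/= in_itv/=; exact: f0.
Qed.

Lemma primitive_lt a b f x : csupp a b f -> x < a -> primitive f x = 0.
Proof.
move=> fab xa; apply: primitive_eq0 => t tx.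
by apply: fab; rewrite negb_and -ltNge (le_lt_trans tx).
Qed.

Lemma primitive_ge a b f x : smooth1 f -> csupp a b f -> b <= x ->
  primitive f x = primitive f b.
Proof.
move=> sf fab bx; apply/eqP; rewrite -subr_eq0.
rewrite /primitive Rintegral_itvB ?ltNyr//; last first.
  by apply: (csupp_integrable _ sf fab).
rewrite (@eq_Rintegral _ _ _ _ _ (cst 0)); first by rewrite /Rintegral integral0.
move=> t; rewrite inE/= in_itv/= => /andP[bt _]; apply: fab.
by rewrite negb_and -!ltNge bt orbT.
Qed.

Lemma primitive_bounded a b f : smooth1 f -> csupp a b f ->
  exists2 C : R, 0 <= C & forall x, `|primitive f x| <= C.
Proof.
move=> sf fab; have [ba|ab] := ltP b a.
  exists 0 => // x; rewrite primitive_eq0 ?normr0// => t _; apply: fab.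
  by apply/negP => /andP[ax xb]; move: (lt_le_trans ba ax); rewrite ltNge xb.
have cf : {within `[a, b], continuous (fun x => `|primitive f x|)}.
  apply: continuous_subspaceT => x.
  by apply: cvg_norm; exact: smooth1_continuous (smooth1_primitive sf fab) _.
have [c _ fc] := EVT_max ab cf.
exists `|primitive f c| => // x.
have [xa|ax] := ltP x a; first by rewrite (primitive_lt fab xa) normr0.
have [xb|/ltW bx] := leP x b; first by apply: fc; rewrite in_itv/= ax.
by rewrite (primitive_ge sf fab bx); apply: fc; rewrite in_itv/= ab lexx.
Qed.

(** The normalised primitive of a bump. One constant bounds both s and s', which is all that the
    cutoffs need quantitatively. *)
Lemma smooth_step : exists s : R -> R, exists2 C : R, 0 <= C &
  [/\ smooth1 s, forall x, x <= 0 -> s x = 0, forall x, 1 <= x -> s x = 1,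
      csupp 0 1 (derive1 s) & forall x, `|s x| <= C /\ `|derive1 s x| <= C].
Proof.
pose B : R -> R := bump 0 1 0; pose Z := primitive B 1.
have sB : smooth1 B by exact: smooth1_bump.
have B01 : csupp 0 1 B by exact: csupp_bump.
have dF := is_derive_primitive sB B01.
have F0 x : x <= 0 -> primitive B x = 0.
  move=> x0; apply: primitive_eq0 => t tx; apply: bump_out.
  by rewrite negb_and -!leNgt (le_trans tx).
have Z0 : 0 < Z.
  rewrite -(F0 0)//; apply: (@gtr0_derive1_lt_cc _ (primitive B) 0 1).
  - by move=> x _; case: (dF x).
  - by move=> x; rewrite in_itv/= (derive1_primitive sB B01); exact: bump_gt0.
  - by apply: continuous_subspaceT; apply: smooth1_continuous (smooth1_primitive sB B01).
  - by rewrite in_itv/= lexx ler01.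
  - by rewrite in_itv/= lexx ler01.
  - exact: ltr01.
have [C1 C10 FC] := primitive_bounded sB B01.
have ds (x : R) : is_derive x 1 (fun x => Z^-1 * primitive B x) (Z^-1 * B x).
  exact: (is_deriveZ Z^-1 (dF x)).
have sZB : smooth1 (fun x => Z^-1 * B x) := smooth1M (@smooth1_cst Z^-1) sB.
exists (fun x => Z^-1 * primitive B x).
(* [C1] bounds the primitive and 1 bounds the bump; their sum serves for both. *)
exists (Z^-1 * (C1 + 1)); first by rewrite mulr_ge0 ?addr_ge0// invr_ge0 ltW.
rewrite (is_derive_derive1 ds); split.
- exact: smooth1_of_derive ds sZB.
- by move=> x x0; rewrite F0// mulr0.
- by move=> x x1; rewrite (primitive_ge sB B01 x1) mulVf// gt_eqF.
- by move=> x x01; rewrite B01// mulr0.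
- move=> x; split; rewrite [X in X <= _]normrM (@gtr0_norm _ Z^-1) ?invr_gt0//;
    apply: ler_wpM2l; rewrite ?invr_ge0 ?(ltW Z0)//.
    by rewrite (le_trans (FC x))// lerDl.
  rewrite (ger0_norm (bump_ge0 0 1 0 x : 0 <= B x)).
  by rewrite (le_trans (bump_le1 _ _ _ _))// lerDr.
Qed.

End smooth_functions.

(** * Products of one-variable functions as test functions *)

Section tensor_test_functions.
Context {R : realType}.
Implicit Types (a b : R -> R).

Definition tensor a b : R * R -> R := fun z => a z.1 * b z.2.

(** All omega-derivatives fall on a and all R-derivatives on b, so the order in which [partial]
    takes them does not matter. *)
Lemma partial_tensor a b i j : smooth1 a -> smooth1 b ->
  partial i j (tensor a b) = tensor (derive1n i a) (derive1n j b).
Proof.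
move=> sa sb; rewrite /partial.
have -> : iter j partial_rho (tensor a b) = tensor a (derive1n j b).
  elim: j => [//|j IH]; rewrite iterS IH; apply/funext => -[x y].
  rewrite derive1nS /partial_rho /tensor !derive1E /=.
  rewrite (@deriveMl _ R (derive1n j b))//; exact: sb.
elim: i => [//|i IH]; rewrite iterS IH; apply/funext => -[x y].
rewrite derive1nS /partial_omega /tensor !derive1E /=.
rewrite (@deriveMr _ R (derive1n i a)) 1?mulrC//; exact: sa.
Qed.

Lemma smooth_tensor a b : smooth1 a -> smooth1 b -> smooth (tensor a b).
Proof.
move=> sa sb i j; rewrite partial_tensor//; split.
- have ca := smooth1_continuous (@smooth1_derive1n _ i _ sa).
  have cb := smooth1_continuous (@smooth1_derive1n _ j _ sb).
  move=> z; apply: cvgM.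
    apply: (@cvg_comp _ _ _ fst (derive1n i a) _ _ _ _ (ca z.1)); exact: cvg_fst.
  apply: (@cvg_comp _ _ _ snd (derive1n j b) _ _ _ _ (cb z.2)); exact: cvg_snd.
- move=> z; rewrite /tensor/=; apply: derivableM => //; exact: sa.
- move=> z; rewrite /tensor/=; apply: derivableM => //; exact: sb.
Qed.

Lemma test_function_tensor (theta0 R0 c d c' d' : R) a b :
  0 < c -> d < theta0 -> R0 < c' ->
  smooth1 a -> csupp c d a -> smooth1 b -> csupp c' d' b ->
  test_function theta0 R0 (tensor a b).
Proof.
move=> c0 dt Rc' sa acd sb bcd; split; first exact: smooth_tensor.
exists (`[c, d] `*` `[c', d']); split.
- by apply: compact_setX; exact: segment_compact.
- move=> [x y] [/=]; rewrite !in_itv/= => /andP[cx xd] /andP[cy yd].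
  rewrite /Omega; split; rewrite /= in_itv/= ?andbT.
    by rewrite (lt_le_trans c0)//= (le_lt_trans xd).
  by rewrite (lt_le_trans Rc').
- move=> [x y] /= nK; rewrite /tensor /=.
  have [xcd|/acd->] := boolP (c <= x <= d); last by rewrite mul0r.
  rewrite bcd ?mulr0//; apply/negP => ycd; apply: nK.
  by split; rewrite /= in_itv.
Qed.

Lemma weak_derivative_tensor (theta0 R0 c d c' d' : R) i j (u g : R * R -> R) a b :
  is_weak_derivative theta0 R0 i j u g ->
  0 < c -> d < theta0 -> R0 < c' ->
  smooth1 a -> csupp c d a -> smooth1 b -> csupp c' d' b ->
  \int[plane_measure]_(z in Omega theta0 R0)
    (u z * (derive1n i a z.1 * derive1n j b z.2)) =
  (-1) ^+ (i + j) *
  \int[plane_measure]_(z in Omega theta0 R0) (g z * (a z.1 * b z.2)).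
Proof.
move=> [_ _ ug] c0 dt Rc' sa acd sb bcd.
have := ug _ (test_function_tensor c0 dt Rc' sa acd sb bcd).
by rewrite partial_tensor.
Qed.

End tensor_test_functions.

(** * Functions orthogonal to all products of bumps vanish *)

Section dynkin_integral.
Context d (T : measurableType d) (R : realType) (mu : {measure set T -> \bar R}).
Local Open Scope ereal_scope.

(** The sets A whose preimage carries zero integral form a Dynkin system, hence a generating family
    closed under intersection decides. The map h lets the same argument run for each coordinate
    projection and for the plane itself. *)
Lemma integral0_preimage d' (T' : measurableType d') (h : T -> T')
    (f : T -> \bar R) (Q : set T) (G : set (set T')) :
  measurable_fun setT h -> measurable Q -> mu.-integrable Q f ->
  \int[mu]_(x in Q) f x = 0 ->
  measurable = <<s G >> -> setI_closed G ->
  (forall A, G A -> \int[mu]_(x in h @^-1` A `&` Q) f x = 0) ->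
  forall A, measurable A -> \int[mu]_(x in h @^-1` A `&` Q) f x = 0.
Proof.
move=> mh mQ intf f0 mG GI fG A mA.
have mhA B : measurable B -> measurable (h @^-1` B).
  by move=> mB; rewrite -[_ @^-1` _]setTI; exact: mh.
apply: (dynkin_induction (P := fun A => \int[mu]_(x in h @^-1` A `&` Q) f x = 0) mG)=> //.
- by rewrite preimage_setT setTI.
- move=> S mS hS; have : \int[mu]_(x in (h @^-1` S `&` Q) `|` (h @^-1` (~` S) `&` Q)) f x = 0.
    by rewrite -setIUl -preimage_setU setUv preimage_setT setTI.
  rewrite integral_setU//; last 4 first.
  + by apply: measurableI => //; exact: mhA.
  + by apply: measurableI => //; apply: mhA; exact: measurableC.
  + apply: measurable_funS (measurable_int _ intf) => //.
    by rewrite -setIUl; exact: subIsetr.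
  + by apply/disj_set2P; rewrite setIACA -preimage_setI setICr preimage_set0 set0I.
  by rewrite hS add0e.
- move=> F mF tF hF; rewrite preimage_bigcup setI_bigcupl integral_bigcup//.
  + by rewrite (eq_eseriesr (g := cst 0)) ?eseries0// => i _; exact: hF.
  + by move=> i j _ _ [x [[Fi _] [Fj _]]]; apply: (tF i j) => //; exists (h x).
  + by move=> k; apply: measurableI => //; exact: mhA.
  + apply: integrableS intf => //.
      by apply: bigcupT_measurable => k; apply: measurableI => //; exact: mhA.
    by move=> x [i _ []].
- by rewrite -mG.
Qed.
End dynkin_integral.

Section rectangles.
Context {R : realType}.
Notation T := (measurableTypeR R * measurableTypeR R)%type.
Local Open Scope ereal_scope.

Lemma itvooI (a b c d : R) :
  `]a, b[ `&` `]c, d[ = `](Num.max a c), (Num.min b d)[%classic.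
Proof.
apply/seteqP; split => x /=; rewrite !in_itv/= gt_max lt_min.
  by move=> [/andP[-> ->] /andP[-> ->]].
by move=> /andP[/andP[-> ->] /andP[-> ->]].
Qed.

Lemma itvoo_setI_closed :
  setI_closed [set A : set (measurableTypeR R) | exists x y, A = `]x, y[%classic].
Proof.
move=> _ _ [a [b ->]] [c [d ->]]; exists (Num.max a c), (Num.min b d).
exact: itvooI.
Qed.

Lemma measurableE_itvoo : @measurable _ (measurableTypeR R) =
  <<s [set A : set (measurableTypeR R) | exists x y, A = `]x, y[%classic] >>.
Proof. exact: RGenOpens.measurableE. Qed.

(** Three applications of [integral0_preimage]: one side of the rectangle is freed from being an
    interval, next the other, and finally measurable rectangles generate the product
    sigma-algebra. *)
Lemma integral0_rectangles (mu : {measure set T -> \bar R}) (f : T -> \bar R)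
    (Q : set T) (mQ : measurable Q) : mu.-integrable Q f ->
  (exists a b a' b', Q = `]a, b[ `*` `]a', b'[) ->
  (forall a b a' b', \int[mu]_(z in (`]a, b[ `*` `]a', b'[) `&` Q) f z = 0) ->
  forall A, measurable A -> \int[mu]_(z in A `&` Q) f z = 0.
Proof.
move=> intf Qab f0 A mA.
have Q0 : \int[mu]_(z in Q) f z = 0.
  have [a [b [a' [b' QE]]]] := Qab.
  by rewrite -[Q in LHS]setIid {1}QE f0.
have mS2 B : measurable B -> measurable (snd @^-1` B `&` Q).
  by move=> mB; apply: measurableI => //; rewrite -[_ @^-1` _]setTI; exact: measurable_snd.
have f1 A1 a' b' : measurable A1 ->
    \int[mu]_(z in fst @^-1` A1 `&` (snd @^-1` `]a', b'[ `&` Q)) f z = 0.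
  apply: (integral0_preimage (T' := measurableTypeR R) _ _ _ _ measurableE_itvoo itvoo_setI_closed).
  - exact: measurable_fst.
  - exact: mS2.
  - by apply: integrableS intf => //; exact: mS2.
  - have [a [b [c' [d' QE]]]] := Qab.
    rewrite -(f0 a b a' b'); congr (integral _ _ _).
    rewrite QE; apply/seteqP; split => [[x y] [/= H [H1 H2]]|[x y] [[/= H1 H2] [_ H3]]] //.
  - move=> _ [a [b ->]]; rewrite -(f0 a b a' b'); congr (integral _ _ _).
    by rewrite setIA.
have f2 A1 A2 : measurable A1 -> measurable A2 ->
    \int[mu]_(z in snd @^-1` A2 `&` (fst @^-1` A1 `&` Q)) f z = 0.
  move=> mA1; have mS1 : measurable (fst @^-1` A1 `&` Q).
    by apply: measurableI => //; rewrite -[_ @^-1` _]setTI; exact: measurable_fst.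
  apply: (integral0_preimage (T' := measurableTypeR R) _ _ _ _ measurableE_itvoo itvoo_setI_closed).
  - exact: measurable_snd.
  - exact: mS1.
  - by apply: integrableS intf => //; exact: mS1.
  - have [a [b [c' [d' QE]]]] := Qab.
    rewrite -(f1 A1 c' d' mA1); congr (integral _ _ _).
    rewrite QE; apply/seteqP; split => [[x y] [/= H [H1 H2]]|[x y] [/= H [_ [H1 H2]]]] //.
  - by move=> _ [a [b ->]]; rewrite -(f1 A1 a b mA1) setICA.
have := @integral0_preimage _ T R mu _ T id f Q _ _ mQ intf Q0
  (measurable_prod_measurableType (measurableTypeR R) (measurableTypeR R)).
apply => //.
- move=> _ _ [A1 mA1 [B1 mB1 <-]] [A2 mA2 [B2 mB2 <-]].
  exists (A1 `&` A2); first exact: measurableI.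
  exists (B1 `&` B2); first exact: measurableI.
  by rewrite setXI.
- move=> _ [A1 mA1 [B1 mB1 <-]]; rewrite -(f2 A1 B1 mA1 mB1); congr (integral _ _ _).
  by apply/seteqP; split => [[x y] [[/= H1 H2] H3]|[x y] [/= H1 [H2 H3]]].
Qed.

Lemma smooth1_measurableR (a : R -> R) : smooth1 a ->
  measurable_fun [set: measurableTypeR R] a.
Proof. by move=> sa; exact: smooth1_measurable. Qed.

Lemma measurable_tensor (a b : R -> R) (D : set T) : smooth1 a -> smooth1 b ->
  measurable_fun D (fun z : T => (a z.1 * b z.2)%R).
Proof.
move=> sa sb; apply: (@measurable_funS _ _ _ _ setT) => //.
apply: measurable_funM.
  exact: (measurableT_comp (smooth1_measurableR sa) measurable_fst).
exact: (measurableT_comp (smooth1_measurableR sb) measurable_snd).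
Qed.

Lemma integral_eq_out (mu : {measure set T -> \bar R}) (A B : set T) (f : T -> \bar R) :
  A `<=` B -> (forall z, B z -> ~ A z -> f z = 0) ->
  \int[mu]_(z in B) f z = \int[mu]_(z in A) f z.
Proof.
move=> AB f0; rewrite integral_mkcond [RHS]integral_mkcond.
congr (integral _ _ _); apply/funext => z; rewrite !patchE.
case: ifPn => [|/negP zB].
  by rewrite inE => zB; case: ifPn => // /negP zA; apply: f0 => // /mem_set.
by case: ifPn => // /set_mem/AB/mem_set.
Qed.

(** Dominated convergence: the products of bumps lie between 0 and 1 and tend to the indicator of
    the open rectangle, so |f| dominates. *)
Lemma integral_rectangle0 (theta0 R0 c d c' d' : R) (f : T -> R) :
  (0 <= c)%R -> (d <= theta0)%R -> (R0 <= c')%R ->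
  plane_measure.-integrable (`]c, d[ `*` `]c', d'[) (EFin \o f) ->
  (forall n, \int[plane_measure]_(z in Omega theta0 R0)
     (f z * (bump c d n z.1 * bump c' d' n z.2)) = 0)%R ->
  \int[plane_measure]_(z in `]c, d[ `*` `]c', d'[) (f z)%:E = 0.
Proof.
move=> c0 dt Rc intf f0; set Q : set T := _ `*` _ in intf *.
have mQ : measurable Q by apply: measurableX; exact: measurable_itv.
have mf : measurable_fun Q f by apply/measurable_EFinP; exact: measurable_int intf.
pose f_ n z := (f z * (bump c d n z.1 * bump c' d' n z.2))%:E.
have mf_ n : measurable_fun Q (f_ n).
  apply/measurable_EFinP; apply: measurable_funM => //.
  by apply: measurable_tensor; exact: smooth1_bump.
have f_le n z : `|f_ n z| <= `|(f z)%:E|.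
  rewrite /f_ EFinM abseM -[leRHS]mule1; apply: lee_wpmul2l => //.
  rewrite gee0_abs lee_fin ?(mulr_ge0 (bump_ge0 _ _ _ _) (bump_ge0 _ _ _ _))//.
  by rewrite mulr_ile1// ?bump_ge0// bump_le1.
have intf_ n : plane_measure.-integrable Q (f_ n).
  by apply: le_integrable intf.
have int0 n : \int[plane_measure]_(z in Q) f_ n z = 0.
  (* The hypothesis concerns [fine] of the integral, which also vanishes at infinite values;
     integrability of [f_ n] excludes them. *)
  rewrite -[LHS]fineK; last exact: integrable_fin_num (intf_ n).
  congr (_%:E); rewrite -[RHS](f0 n) /Rintegral; congr fine; symmetry.
  apply: integral_eq_out.
    move=> [x y] [/=]; rewrite !in_itv/= => /andP[cx xd] /andP[cy _].
    rewrite /Omega; split; rewrite /= in_itv/= ?andbT.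
      by rewrite (le_lt_trans c0)//= (lt_le_trans xd).
    by rewrite (le_lt_trans Rc).
  move=> [x y] _ nQ /=; congr (_%:E).
  have [xcd|/bump_out->] := boolP (c < x < d)%R; last by rewrite mul0r mulr0.
  rewrite [X in (_ * (_ * X))%R]bump_out ?mulr0//; apply/negP => ycd; apply: nQ.
  by split; rewrite /= in_itv.
have [|||_ _] := @dominated_convergence _ _ _ plane_measure Q mQ f_ (EFin \o f)
  (fun z => `|(f z)%:E|) mf_ (measurable_int _ intf).
- apply: aeW => -[x y] [/= xcd ycd]; apply: cvg_EFin; first by near=> n.
  rewrite /f_ /= -[X in _ --> X]mulr1; apply: cvgM; first exact: cvg_cst.
  have := cvgM (@bump_cvg R c d x) (@bump_cvg R c' d' y).
  by rewrite !indicE !mem_set// mulr1; apply; exact: eventually_filter.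
- exact: integrable_abse.
- by apply: aeW => z n _; exact: f_le.
have -> : [sequence \int[plane_measure]_(x in Q) f_ n x]_n = cst 0.
  by apply/funext => n /=; exact: int0.
move=> H; exact: (cvg_unique (@ereal_hausdorff R) H (cvg_cst _)).
Unshelve. all: by end_near. Qed.

(** Integrability is available only on bounded rectangles away from the boundary, so Omega is
    exhausted by the rectangles [Q n] at distance 1/(n+1) from it. On each of them f has zero
    integral over every subrectangle, hence over every measurable subset; the exceptional null sets
    are then united over n. *)
Lemma ae_eq0_Omega (theta0 R0 : R) (f : T -> R) :
  measurable_fun (Omega theta0 R0 : set T) f ->
  (forall c d c' d', 0 < c -> d < theta0 -> R0 < c' ->
    plane_measure.-integrable (`]c, d[ `*` `]c', d'[) (EFin \o f))%R ->
  (forall c d c' d' n, 0 < c -> d < theta0 -> R0 < c' ->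
    \int[plane_measure]_(z in Omega theta0 R0)
     (f z * (bump c d n z.1 * bump c' d' n z.2)) = 0)%R ->
  {ae plane_measure, forall z, Omega theta0 R0 z -> f z = 0%R}.
Proof.
move=> mf intf f0.
pose e n : R := (n.+1%:R^-1)%R.
have e0 n : (0 < e n)%R by rewrite invr_gt0.
pose Q n : set T := `]e n, (theta0 - e n)%R[ `*` `](R0 + e n)%R, (R0 + n.+1%:R)%R[.
have mQ n : measurable (Q n) by apply: measurableX; exact: measurable_itv.
have intQ n : plane_measure.-integrable (Q n) (EFin \o f).
  by apply: intf; rewrite ?ltrDl// ltrBlDr ltrDl.
have aeQ n : {ae plane_measure, forall z, Q n z -> f z = 0%R}.
  have : ae_eq plane_measure (Q n) (EFin \o f) (cst 0).
    apply: (integral_ae_eq (mQ n) (intQ n)) => //.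
    move=> A AQ mA; rewrite integral0 -(setIidl AQ).
    apply: integral0_rectangles => //; first by do 4 eexists; reflexivity.
    move=> a b a' b'; rewrite /Q.
    rewrite -setXI !itvooI.
    have h1 : (0 < Num.max a (e n))%R by rewrite lt_max e0 orbT.
    have h2 : (Num.min b (theta0 - e n) < theta0)%R by rewrite gt_min ltrBlDr ltrDl e0 orbT.
    have h3 : (R0 < Num.max a' (R0 + e n))%R by rewrite lt_max ltrDl e0 orbT.
    apply: (@integral_rectangle0 theta0 R0); rewrite ?ltW//.
      exact: intf.
    by move=> k; exact: f0.
  by apply: filterS => z /= h Qz; have [] := h Qz.
have := ae_foralln aeQ; apply: filterS => -[x y] fQ [/=].
rewrite !in_itv/= andbT => /andP[x0 xt] yR.
have : exists n, Q n (x, y).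
  suff : \forall n \near \oo, Q n (x, y) by case=> n _ /(_ n (leqnn n)); exists n.
  have ecvg : e n @[n --> \oo] --> (0 : R)%R by exact: cvg_harmonic.
  have eps0 : (0 < Num.min x (Num.min (theta0 - x) (y - R0)))%R.
    by rewrite !lt_min x0 !subr_gt0 xt.
  near=> n.
  have : (e n < Num.min x (Num.min (theta0 - x) (y - R0)))%R.
    by near: n; exact: (cvgr_lt _ ecvg).
  rewrite !lt_min => /and3P[ex et ey].
  have yn : (y - R0 < n.+1%:R)%R.
    rewrite (@lt_le_trans _ _ n%:R)// ?ler_nat//.
    by near: n; exact: nbhs_infty_gtr.
  split; rewrite /= in_itv/=; apply/andP; split; lra.
by move=> [n]; exact: fQ.
Unshelve. all: by end_near. Qed.

End rectangles.

(** * Integrals over half-lines *)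

Section tails.
Context {R : realType}.
Notation L := (measurableTypeR R).
Notation mu := (@lebesgue_measure R).
Implicit Types (h k : L -> R) (T : rel R).
Local Open Scope ereal_scope.

Lemma integrable_bound d (X : measurableType d) (m : {measure set X -> \bar R})
    (D : set X) (f g : X -> R) (C : R) :
  measurable D -> measurable_fun D f -> m.-integrable D (EFin \o g) ->
  (forall x, D x -> `|f x| <= C * `|g x|)%R -> m.-integrable D (EFin \o f).
Proof.
move=> mD mf intg fg; have [C0|C0] := leP 0%R C.
  apply: (@le_integrable _ _ _ _ _ mD _ (fun x => (C * g x)%:E)).
  - exact/measurable_EFinP.
  - by move=> x Dx /=; rewrite lee_fin normrM (ger0_norm C0) fg.
  - by apply: eq_integrable (integrableZl mD C intg) => // x _; rewrite EFinM.
apply: (@le_integrable _ _ _ _ _ mD _ (EFin \o g)) => //.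
- exact/measurable_EFinP.
- move=> x Dx /=; rewrite lee_fin (le_trans (fg x Dx))//.
  by rewrite (@le_trans _ _ 0%R) ?mulr_le0_ge0 ?(ltW C0).
Qed.

Lemma integrable_prodM h k : mu.-integrable setT (EFin \o h) ->
  mu.-integrable setT (EFin \o k) ->
  (mu \x mu).-integrable [set: L * L] (fun z => (h z.1 * k z.2)%:E).
Proof.
move=> ih ik.
have mh : measurable_fun setT h by apply/measurable_EFinP; exact: measurable_int ih.
have mk : measurable_fun setT k by apply/measurable_EFinP; exact: measurable_int ik.
apply/integrable12ltyP.
  apply/measurable_EFinP; apply: measurable_funM.
    exact: (measurableT_comp mh measurable_fst).
  exact: (measurableT_comp mk measurable_snd).
have -> : (fun x => \int[mu]_y `|(h (x, y).1 * k (x, y).2)%:E|) =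
    fun x => `|(h x)%:E| * \int[mu]_y `|(k y)%:E|.
  apply/funext => x /=; rewrite -ge0_integralZl//.
  - by apply: eq_integral => y _; rewrite normrM EFinM.
  - by apply/measurable_EFinP; exact: measurableT_comp.
have /integrableP[_ hoo] := ih; have /integrableP[_ koo] := ik.
have kfin : \int[mu]_y `|(k y)%:E| \is a fin_num.
  by rewrite ge0_fin_numE// integral_ge0.
rewrite -(fineK kfin) ge0_integralZr//; last 2 first.
- by apply/measurable_EFinP; exact: measurableT_comp.
- by rewrite lee_fin fine_ge0// integral_ge0.
by rewrite muleC lte_mul_pinfty// lee_fin fine_ge0// integral_ge0.
Qed.

Lemma measurable_section1 T s : measurable [set z : L * L | T z.1 z.2] ->
  measurable [set t : L | T s t].
Proof. by move=> /(measurable_xsection s); rewrite /xsection/=; under eq_set do rewrite inE/=. Qed.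

Lemma measurable_section2 T t : measurable [set z : L * L | T z.1 z.2] ->
  measurable [set s : L | T s t].
Proof. by move=> /(measurable_ysection t); rewrite /ysection/=; under eq_set do rewrite inE/=. Qed.

Lemma measurable_converse T : measurable [set z : L * L | T z.1 z.2] ->
  measurable [set z : L * L | T z.2 z.1].
Proof.
by move=> mT; have := @measurable_swap _ _ L L measurableT _ mT; rewrite setTI.
Qed.

Lemma integrable_relM T h k : measurable [set z : L * L | T z.1 z.2] ->
  mu.-integrable setT (EFin \o h) -> mu.-integrable setT (EFin \o k) ->
  (mu \x mu).-integrable setT
    (fun z => (h z.1 * k z.2 * \1_[set z : L * L | T z.1 z.2] z)%:E).
Proof.
move=> mT ih ik; have ihk := integrable_prodM ih ik.
apply: le_integrable ihk => //.
  apply/measurable_EFinP; apply: measurable_funM.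
    by apply/measurable_EFinP; exact: measurable_int (integrable_prodM ih ik).
  exact: measurable_indic.
move=> z _ /=; rewrite lee_fin normrM indicE.
by case: (_ \in _); rewrite ?normr1 ?mulr1// normr0 mulr0.
Qed.

Lemma integralEFin_sub (D : set L) f : measurable D ->
  mu.-integrable setT (EFin \o f) ->
  \int[mu]_(t in D) (f t)%:E = (\int[mu]_(t in D) f t)%R%:E.
Proof.
move=> mD intf; rewrite /Rintegral fineK//; apply: integrable_fin_num => //.
exact: integrableS intf.
Qed.

Lemma integral_relM1 T h k (s : L) : measurable [set z : L * L | T z.1 z.2] ->
  mu.-integrable setT (EFin \o k) ->
  \int[mu]_t (h s * k t * \1_[set z : L * L | T z.1 z.2] (s, t))%:E =
  (h s * (\int[mu]_(t in [set t | T s t]) k t)%R)%:E.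
Proof.
move=> mT ik; have mD := measurable_section1 s mT.
rewrite EFinM -integralEFin_sub// [X in _ * X]integral_mkcond -integralZl//; last first.
  by apply/(integrable_mkcond _ mD).1; exact: integrableS ik.
apply: eq_integral => t _; rewrite -mulrA EFinM; congr (_ * _).
rewrite patchE indicE; have [Tst|Tst] := boolP (T s t).
  by rewrite !mem_set//= mulr1.
by rewrite !memNset/= ?mulr0//; exact/negP.
Qed.

Lemma integral_relM2 T h k (t : L) : measurable [set z : L * L | T z.1 z.2] ->
  mu.-integrable setT (EFin \o h) ->
  \int[mu]_s (h s * k t * \1_[set z : L * L | T z.1 z.2] (s, t))%:E =
  (k t * (\int[mu]_(s in [set s | T s t]) h s)%R)%:E.
Proof.
move=> mT ih; have mD := measurable_section2 t mT.
rewrite EFinM -integralEFin_sub// [X in _ * X]integral_mkcond -integralZl//; last first.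
  by apply/(integrable_mkcond _ mD).1; exact: integrableS ih.
apply: eq_integral => s _; rewrite [(h s * _)%R]mulrC -mulrA EFinM; congr (_ * _).
rewrite patchE indicE; have [Tst|Tst] := boolP (T s t).
  by rewrite !mem_set//= mulr1.
by rewrite !memNset/= ?mulr0//; exact/negP.
Qed.

Lemma integrable_rel T h k : measurable [set z : L * L | T z.1 z.2] ->
  mu.-integrable setT (EFin \o h) -> mu.-integrable setT (EFin \o k) ->
  mu.-integrable setT (fun s => (h s * (\int[mu]_(t in [set t | T s t]) k t)%R)%:E).
Proof.
move=> mT ih ik; have := integrable_fubini_F (integrable_relM mT ih ik).
by apply: eq_integrable => // s _; rewrite /fubini_F/= integral_relM1.
Qed.

(** Fubini on the region [T s t]. It plays the role of an integration by parts, carrying a primitive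
    from one factor to the other. *)
Lemma Fubini_rel T h k : measurable [set z : L * L | T z.1 z.2] ->
  mu.-integrable setT (EFin \o h) -> mu.-integrable setT (EFin \o k) ->
  \int[mu]_s (h s * (\int[mu]_(t in [set t | T s t]) k t)%R)%:E =
  \int[mu]_t (k t * (\int[mu]_(s in [set s | T s t]) h s)%R)%:E.
Proof.
move=> mT ih ik; have := Fubini (integrable_relM mT ih ik).
under eq_integral do rewrite /= integral_relM1//.
by under [in X in _ = X -> _]eq_integral do rewrite /= integral_relM2//.
Qed.

(** With [<] this is the integral from minus infinity to x, with [>] the integral from x to plus
    infinity. *)
Definition tail T h x : R := (\int[mu]_(s in [set s | T s x]) h s)%R.

(* Covers [<] and [>] on the line at once. *)
Record null_diag_order T : Prop := NullDiagOrder {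
  ndo_measurable : measurable [set z : L * L | T z.1 z.2];
  ndo_irr : irreflexive T;
  ndo_trans : transitive T;
  ndo_total : forall x y, x != y -> T x y || T y x }.

(* The square of the integral of [h] is a double integral, split along the diagonal
   into two triangles that contribute equally. *)
Lemma tail_sqr T h x : null_diag_order T -> mu.-integrable setT (EFin \o h) ->
  (tail T h x ^+ 2)%:E = 2%:E * \int[mu]_(s in [set s | T s x]) (h s * tail T h s)%:E.
Proof.
move=> [mT irrT trT totT] ih.
pose D : set L := [set s | T s x].
have mD : measurable D by exact: measurable_section2.
(* Cutting h off outside D turns [tail T h x] into an integral over the whole line; transitivity of
   T keeps [tail] unchanged at the points of D. *)
pose g : L -> R := h \_ D.
have ig : mu.-integrable setT (EFin \o g).
  rewrite /g (_ : EFin \o _ = (EFin \o h) \_ D).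
    by apply/(integrable_mkcond _ mD).1; exact: integrableS ih.
  by apply/funext => s; rewrite /= !patchE; case: ifP.
have tg s : D s -> tail T g s = tail T h s.
  move=> Ds; apply: eq_Rintegral => t; rewrite inE/= => Tts.
  by rewrite /g patchE mem_set// /D/=; exact: trT Ds.
pose I := (\int[mu]_s g s)%R.
have IE : tail T h x = I by rewrite /tail Rintegral_mkcond.
(* The line is the disjoint union of the two sides of s and the null set reduced to s. *)
have gsplit s : I = (tail T g s + \int[mu]_(t in [set t | T s t]) g t)%R.
  have m1 := measurable_section1 s mT; have m2 := measurable_section2 s mT.
  have -> : I = (\int[mu]_(t in ([set t | T t s] `|` [set t | T s t]) `|` [set s]) g t)%R.
    congr (Rintegral _ _ _); apply/seteqP; split => // t _.
    by have [->|/totT/orP[]] := eqVneq t s; [right|left; left|left; right].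
  have iS (E : set L) : measurable E -> mu.-integrable E (EFin \o g).
    by move=> mE; exact: integrableS ig.
  rewrite Rintegral_setU//; last 3 first.
  - exact: measurableU.
  - by apply: iS; apply: measurableU => //; exact: measurableU.
  - by apply/disj_set2P; apply/seteqP; split => // t [/= [] + ts]; rewrite ts irrT.
  rewrite Rintegral_set1 addr0 Rintegral_setU//.
  - by apply: iS; exact: measurableU.
  - apply/disj_set2P; apply/seteqP; split => // t [/= ts st].
    by have := trT _ _ _ ts st; rewrite irrT.
have mg : measurable_fun setT g by apply/measurable_EFinP; exact: measurable_int ig.
have gD f : \int[mu]_s (g s * f s)%:E = \int[mu]_(s in D) (h s * f s)%:E.
  rewrite [RHS]integral_mkcond; apply: eq_integral => s _.
  by rewrite /g !patchE; case: ifP => _ //; rewrite mul0r.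
have mT' := measurable_converse mT.
have it : mu.-integrable setT (fun s => (g s * tail T g s)%:E).
  exact: (@integrable_rel (fun s t => T t s)).
have itc := integrable_rel mT ig ig.
have II : (I * I)%:E = \int[mu]_s (I * g s)%:E.
  have IE2 : I%:E = \int[mu]_s (g s)%:E by rewrite /I -integralEFin_sub.
  rewrite EFinM [X in _ * X]IE2 -integralZl//.
(* Of the two pieces into which each s splits I, Fubini exchanges one for the other, whence the
   factor 2. *)
rewrite IE expr2 II.
under eq_integral => s _ do rewrite (gsplit s) mulrC mulrDr EFinD.
rewrite integralD// (Fubini_rel mT ig ig) -mule2n mule_natl; congr (_ *+ _).
rewrite gD; apply: eq_integral => s; rewrite inE => Ds.
by rewrite -tg.
Qed.

Lemma measurable_rlt : measurable [set z : L * L | (z.1 < z.2)%R].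
Proof.
have := @measurable_fun_ltr _ (L * L)%type R setT fst snd measurable_fst measurable_snd.
move=> /(_ measurableT [set true] I); rewrite setTI; congr measurable.
Qed.

Lemma measurable_rgt : measurable [set z : L * L | (z.2 < z.1)%R].
Proof.
have := @measurable_fun_ltr _ (L * L)%type R setT snd fst measurable_snd measurable_fst.
move=> /(_ measurableT [set true] I); rewrite setTI; congr measurable.
Qed.

Lemma null_diag_order_lt : null_diag_order (fun s t => s < t)%R.
Proof.
split; [exact: measurable_rlt|exact: ltxx|exact: lt_trans|].
by move=> x y; rewrite neq_lt.
Qed.

Lemma null_diag_order_gt : null_diag_order (fun s t => t < s)%R.
Proof.
split; [exact: measurable_rgt|exact: ltxx| |].
  by move=> y x z yx zy; exact: lt_trans zy yx.
by move=> x y; rewrite eq_sym neq_lt.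
Qed.

Lemma ae_plane_snd (P : L -> Prop) : {ae mu, forall y, P y} ->
  {ae mu \x mu, forall z : L * L, P z.2}.
Proof.
move=> [N [mN N0 PN]]; exists (setT `*` N); split.
- exact: measurableX.
- by have := product_measure1E mu mu measurableT mN; rewrite -[X in _ * X]/(mu N) N0 mule0.
- by move=> [x y] /= nP; split => //; exact: PN.
Qed.

Lemma ae_plane_fst (P : L -> Prop) : {ae mu, forall x, P x} ->
  {ae mu \x mu, forall z : L * L, P z.1}.
Proof.
move=> [N [mN N0 PN]]; exists (N `*` setT); split.
- exact: measurableX.
- by have := product_measure1E mu mu mN measurableT; rewrite -[X in X * _]/(mu N) N0 mul0e.
- by move=> [x y] /= nP; split => //; exact: PN.
Qed.

Definition swap (z : L * L) : L * L := (z.2, z.1).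

Lemma measurable_swapf : measurable_fun setT swap.
Proof. by apply/measurable_fun_pairP; split; [exact: measurable_snd|exact: measurable_fst]. Qed.

Lemma integrable_swap (f : L * L -> \bar R) :
  (mu \x mu).-integrable setT f -> (mu \x mu).-integrable setT (f \o swap).
Proof.
move=> intf; have mf := measurable_int _ intf.
apply/integrable21ltyP; first exact: measurableT_comp measurable_swapf.
by have /integrable12ltyP := intf; apply.
Qed.

Lemma integral_swap (f : L * L -> \bar R) : (mu \x mu).-integrable setT f ->
  \int[mu \x mu]_z f (swap z) = \int[mu \x mu]_z f z.
Proof.
move=> intf; rewrite -(integral21_prod_meas1 (integrable_swap intf)).
by rewrite -(integral12_prod_meas1 intf).
Qed.

(** The first variable is the one integrated; the R direction is reached by composing with
    [swap]. *)
Definition plane_tail T (G : L * L -> R) (z : L * L) : R :=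
  tail T (fun s => G (s, z.2)) z.1.

(** Tonelli, applied separately to the positive and negative parts of a function of three real
    variables. This also covers the slices on which the integral is not finite and [fine] returns a
    default value. *)
Lemma measurable_plane_tail T (G : L * L -> R) :
  measurable [set z : L * L | T z.1 z.2] -> measurable_fun setT G ->
  measurable_fun setT (plane_tail T G).
Proof.
move=> mT mG.
pose F (p : (L * L) * L) : \bar R :=
  (G (p.2, p.1.2) * \1_[set z : L * L | T z.1 z.2] (p.2, p.1.1))%:E.
have mp1 : measurable_fun setT (fun p : (L * L) * L => (p.2, p.1.2)).
  apply/measurable_fun_pairP; split => /=; first exact: measurable_snd.
  exact: (measurableT_comp measurable_snd measurable_fst).
have mp2 : measurable_fun setT (fun p : (L * L) * L => (p.2, p.1.1)).
  apply/measurable_fun_pairP; split => /=; first exact: measurable_snd.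
  exact: (measurableT_comp measurable_fst measurable_fst).
have mF : measurable_fun setT F.
  apply/measurable_EFinP; apply: measurable_funM.
    exact: (measurableT_comp mG mp1).
  exact: (measurableT_comp (measurable_indic mT) mp2).
have tE : plane_tail T G = fun z => fine (\int[mu]_s F^\+ (z, s) - \int[mu]_s F^\- (z, s)).
  apply/funext => -[x y]; rewrite /plane_tail /tail /Rintegral/=; congr fine.
  rewrite integral_mkcond.
  have -> : (fun s => (G (s, y))%:E) \_ [set s | T s x] = (fun s => F ((x, y), s)).
    apply/funext => s; rewrite patchE /F indicE/=.
    have [Tsx|Tsx] := boolP (T s x); first by rewrite !mem_set//= mulr1.
    by rewrite !memNset/= ?mulr0//; exact/negP.
  rewrite integralE; congr (_ - _); apply: eq_integral => s _.
    by rewrite funepos_comp.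
  by rewrite funeneg_comp.
rewrite tE; apply: measurableT_comp => //.
apply: emeasurable_funB.
  by apply: (measurable_fun_fubini_tonelli_F F^\+) => //; exact: measurable_funepos.
by apply: (measurable_fun_fubini_tonelli_F F^\-) => //; exact: measurable_funeneg.
Qed.

(** * Integration by parts along one coordinate of the plane *)

Section plane_rel.
(** The weight K relaxes the integrability of G in the variable that is not integrated: it is
    [decay] for the omega direction and the constant 1 for the R direction. *)
Variables (T : rel R) (G : L * L -> R) (K : L -> R).
Hypothesis mT : measurable [set z : L * L | T z.1 z.2].
Hypothesis mG : measurable_fun setT G.
Hypothesis K0 : forall y, (0 < K y)%R.
Hypothesis iG : (mu \x mu).-integrable setT (fun z => (G z * K z.2)%:E).

Lemma ae_slice : {ae mu, forall y, mu.-integrable setT (fun x => (G (x, y))%:E)}.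
Proof.
have := ae_integrable2 iG; apply: filterS => y /= iGy.
apply: (integrable_bound (C := (K y)^-1) _ _ iGy) => //.
  exact: (measurableT_comp mG (pair2_measurable y)).
move=> x _; rewrite normrM (gtr0_norm (K0 y)) mulrCA mulVf ?mulr1//.
by rewrite gt_eqF.
Qed.

Lemma plane_tail_le y x : mu.-integrable setT (fun x => (G (x, y))%:E) ->
  `|(plane_tail T G (x, y))%:E| <= \int[mu]_s `|(G (s, y))%:E|.
Proof.
move=> iGy; have mD := measurable_section2 x mT.
have -> : (plane_tail T G (x, y))%:E = \int[mu]_(s in [set s | T s x]) (G (s, y))%:E.
  by rewrite integralEFin_sub.
apply: (@le_trans _ _ (\int[mu]_(s in [set s | T s x]) `|(G (s, y))%:E|)).
  apply: le_abse_integral => //.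
  by apply: measurable_funS (measurable_int _ iGy).
apply: ge0_subset_integral => //.
by apply: measurableT_comp => //; exact: measurable_int iGy.
Qed.

(** On almost every slice the tail is bounded, uniformly in x, by the L1 norm of the slice. The
    factor a is integrable in x, and |b| <= C K leaves the integral of |G| K, which is finite. *)
Lemma integrable_plane_tail (a b : L -> R) (C : R) :
  mu.-integrable setT (EFin \o a) -> measurable_fun setT b ->
  (forall y, `|b y| <= C * K y)%R ->
  (mu \x mu).-integrable setT (fun z => (plane_tail T G z * (a z.1 * b z.2))%:E).
Proof.
move=> ia mb bK.
have ma : measurable_fun setT a by apply/measurable_EFinP; exact: measurable_int ia.
have m1r : measurable_fun setT (fun z : L * L => plane_tail T G z * (a z.1 * b z.2))%R.
  apply: measurable_funM; first exact: measurable_plane_tail.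
  apply: measurable_funM.
    exact: (measurableT_comp ma measurable_fst).
  exact: (measurableT_comp mb measurable_snd).
have m1 : measurable_fun setT (fun z : L * L => (plane_tail T G z * (a z.1 * b z.2))%:E).
  exact/measurable_EFinP.
have C0 : (0 <= C)%R.
  have := le_trans (normr_ge0 _) (bK 0%R); by rewrite pmulr_lge0.
apply/integrable21ltyP => //.
pose I := \int[mu]_x `|(a x)%:E|.
have I0 : 0 <= I by exact: integral_ge0.
have Ioo : I < +oo by have /integrableP[] := ia.
pose M y := \int[mu]_s `|(G (s, y) * K y)%:E|.
have mM : measurable_fun setT M.
  apply: (measurable_fun_fubini_tonelli_G (fun z : L * L => `|(G z * K z.2)%:E|)) => //.
  by apply: measurableT_comp => //; exact: measurable_int iG.
have M0 y : 0 <= M y by exact: integral_ge0.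
apply: (@le_lt_trans _ _ (\int[mu]_y (C%:E * I * M y))).
  apply: ae_ge0_le_integral => //.
  - by move=> y _; exact: integral_ge0.
  - apply: (measurable_fun_fubini_tonelli_G
      (fun z : L * L => `|(plane_tail T G z * (a z.1 * b z.2))%:E|)) => //.
    exact: measurableT_comp.
  - by move=> y _; rewrite !mule_ge0// lee_fin.
  - apply: emeasurable_funM => //; exact: measurable_cst.
  have := ae_slice; apply: filterS => y iGy _ /=.
  have -> : C%:E * I * M y = \int[mu]_x (C%:E * M y * `|(a x)%:E|).
    rewrite ge0_integralZl//; last by rewrite mule_ge0// lee_fin.
      by rewrite muleAC.
    by apply: measurableT_comp => //; exact: measurable_int ia.
  apply: ge0_le_integral => //.
  - apply/measurable_EFinP; apply: measurableT_comp => //.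
    exact: (measurableT_comp m1r (pair2_measurable y)).
  - apply: emeasurable_funM; first exact: measurable_cst.
    by apply: measurableT_comp => //; exact: measurable_int ia.
  move=> x _; rewrite -[leLHS]/(`|(plane_tail T G (x, y) * (a x * b y))%:E|).
  rewrite !EFinM !abseM muleCA [leRHS]muleC.
  apply: lee_wpmul2l => //; rewrite muleC.
  have -> : M y = (K y)%:E * \int[mu]_s `|(G (s, y))%:E|.
    rewrite -ge0_integralZl//; last 2 first.
    - by apply: measurableT_comp => //; exact: measurable_int iGy.
    - by rewrite lee_fin ltW.
    apply: eq_integral => s _.
    by rewrite EFinM abseM muleC (gee0_abs (x := (K y)%:E))// lee_fin ltW.
  rewrite muleA; apply: lee_pmul => //; last exact: plane_tail_le.
  by rewrite -EFinM lee_fin.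
rewrite ge0_integralZl//; last by rewrite mule_ge0// lee_fin.
apply: lte_mul_pinfty.
- by rewrite mule_ge0// lee_fin.
- by rewrite fin_numM// ge0_fin_numE.
- by have /integrable21ltyP := iG; apply; exact: measurable_int iG.
Qed.

(** On almost every slice this is [Fubini_rel], with b constant: the tail of G tested against a is G
    tested against the primitive A of a taken from the opposite end. *)
Lemma integral_plane_rel (a b : L -> R) (A : L -> R) (C C' : R) :
  mu.-integrable setT (EFin \o a) -> measurable_fun setT b ->
  (forall y, `|b y| <= C * K y)%R ->
  (forall x, A x = \int[mu]_(t in [set t | T x t]) a t)%R ->
  measurable_fun setT A -> (forall x, `|A x| <= C')%R ->
  \int[mu \x mu]_z (G z * (A z.1 * b z.2))%:E =
  \int[mu \x mu]_z (plane_tail T G z * (a z.1 * b z.2))%:E.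
Proof.
move=> ia mb bK AE mA AC.
have iH := integrable_plane_tail ia mb bK.
have iL : (mu \x mu).-integrable setT (fun z : L * L => (G z * (A z.1 * b z.2))%:E).
  apply: (integrable_bound (C := C' * C) _ _ iG) => //.
    apply: measurable_funM => //; apply: measurable_funM.
      exact: (measurableT_comp mA measurable_fst).
    exact: (measurableT_comp mb measurable_snd).
  move=> z _; rewrite !normrM (gtr0_norm (K0 _)) [leRHS]mulrCA.
  by apply: ler_wpM2l => //; rewrite -[leRHS]mulrA; apply: ler_pM.
rewrite -(integral21_prod_meas1 iL) -(integral21_prod_meas1 iH).
apply: ae_eq_integral => //.
- by have /measurable_int := integrable_fubini_F (integrable_swap iL).
- by have /measurable_int := integrable_fubini_F (integrable_swap iH).
have := ae_slice; apply: filterS => y iGy _; rewrite /fubini_G/=.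
have -> : \int[mu]_x (G (x, y) * (A x * b y))%:E =
    \int[mu]_x ((b y)%:E * (G (x, y) * A x)%:E).
  by apply: eq_integral => x _; rewrite -EFinM; congr EFin; ring.
have -> : \int[mu]_x (plane_tail T G (x, y) * (a x * b y))%:E =
    \int[mu]_x ((b y)%:E * (a x * tail T (fun s => G (s, y)) x)%:E).
  by apply: eq_integral => x _; rewrite -EFinM; congr EFin; rewrite /plane_tail/=; ring.
have mT' := measurable_converse mT.
rewrite !integralZl//; first last.
- by have := integrable_rel mT iGy ia; apply: eq_integrable => // x _; rewrite AE.
- exact: (@integrable_rel (fun s t => T t s)).
congr (_ * _); rewrite -(Fubini_rel mT iGy ia).
by apply: eq_integral => x _; rewrite AE.
Qed.
End plane_rel.

End tails.

(** * Cutoffs at omega = 0 and at infinity *)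

Section cutoffs.
Context {R : realType}.
Notation L := (measurableTypeR R).
Notation mu := (@lebesgue_measure R).
Notation mu2 := (mu \x mu)%E.
Implicit Types (a b : R -> R) (U W G : L * L -> R).

(** Its square is integrable on the line, so weighted L2 functions on the strip become integrable
    after multiplication by it; up to a constant it also dominates every bounded function of compact
    support. *)
Definition decay (y : R) : R := (1 + `|y|)^-1.

Lemma decay_gt0 y : 0 < decay y.
Proof. by rewrite invr_gt0 ltr_wpDr. Qed.

Lemma measurable_decay : measurable_fun [set: L] decay.
Proof.
apply: (@measurable_funS _ _ _ _ setT) => //; apply: continuous_measurable_fun => x.
apply: cvgV; first by rewrite gt_eqF// ltr_wpDr.
by apply: cvgD; [exact: cvg_cst|apply: cvg_norm; exact: cvg_id].
Qed.

Lemma decay_ge (c d y : R) : c <= y <= d -> 1 <= (1 + (`|c| + `|d|)) * decay y.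
Proof.
move=> /andP[cy yd]; rewrite ler_pdivlMr ?ltr_wpDr// mul1r lerD2l.
have hc : - `|c| <= c by rewrite lerNl -normrN ler_norm.
have hd := ler_norm d; have := normr_ge0 c; have := normr_ge0 d => d0 c0.
by rewrite ler_norml; apply/andP; split; lra.
Qed.

Lemma csupp_decay c d b : smooth1 b -> csupp c d b ->
  exists2 C : R, 0 <= C & forall y, `|b y| <= C * decay y.
Proof.
move=> sb bcd; have [C C0 bC] := csupp_bounded sb bcd.
exists (C * (1 + (`|c| + `|d|))); first by rewrite mulr_ge0 ?addr_ge0.
move=> y; have [ycd|ycd] := boolP (c <= y <= d); last first.
  by rewrite bcd// normr0 !mulr_ge0 ?addr_ge0// ltW// decay_gt0.
by rewrite -mulrA -[leLHS]mulr1 ler_pM// decay_ge.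
Qed.

Lemma Rintegral_dominated d (X : measurableType d) (m : {measure set X -> \bar R})
    (f_ : nat -> X -> R) (f g : X -> R) :
  (forall n, measurable_fun setT (f_ n)) -> measurable_fun setT f ->
  (forall x, f_ n x @[n --> \oo] --> f x) ->
  m.-integrable setT (EFin \o g) -> (forall n x, `|f_ n x| <= g x) ->
  \int[m]_x f_ n x @[n --> \oo] --> \int[m]_x f x.
Proof.
move=> mf_ mf f_f ig f_g.
have mfE n : measurable_fun setT (EFin \o f_ n) by exact/measurable_EFinP.
have [||||iF _] := @dominated_convergence _ _ _ m setT measurableT
    (fun n => EFin \o f_ n) (EFin \o f) (EFin \o g) mfE.
- exact/measurable_EFinP.
- by apply: aeW => x _; apply: cvg_EFin; [near=> n|exact: f_f].
- by [].
- by apply: aeW => x n _; rewrite /= lee_fin.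
move=> H; rewrite /Rintegral.
apply: (@fine_cvg R nat \oo _ (fun n => \int[m]_x (f_ n x)%:E)%E).
rewrite fineK//; exact: integrable_fin_num iF.
Unshelve. all: by end_near. Qed.

Lemma integrable_decayM (W : L * L -> R) (k b : R -> R) (C Cb : R) :
  measurable_fun setT W ->
  mu2.-integrable setT (fun z => (W z * decay z.2)%:E) ->
  measurable_fun [set: L] k -> measurable_fun [set: L] b ->
  (forall x, `|k x| <= C) -> (forall y, `|b y| <= Cb * decay y) ->
  mu2.-integrable setT (fun z => (W z * (k z.1 * b z.2))%:E).
Proof.
move=> mW iW mk mb kC bC.
apply: (integrable_bound (C := C * Cb) _ _ iW) => //.
  apply: measurable_funM => //; apply: measurable_funM.
    exact: (measurableT_comp mk measurable_fst).
  exact: (measurableT_comp mb measurable_snd).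
move=> z _; rewrite !normrM (gtr0_norm (decay_gt0 _)) [leRHS]mulrCA.
by apply: ler_wpM2l => //; rewrite -[leRHS]mulrA; apply: ler_pM.
Qed.

Lemma abs_Rintegral_le d (X : measurableType d) (m : {measure set X -> \bar R})
    (f : X -> R) : measurable_fun setT f ->
  (`|\int[m]_x f x|%:E <= \int[m]_x `|(f x)%:E|)%E.
Proof.
move=> mf; apply: le_trans (le_abse_integral _ _ _) => //; last exact/measurable_EFinP.
by rewrite /Rintegral; case: (\int[m]_x _)%E => //=; rewrite ?lee_fin ?normr0 ?leey.
Qed.

Lemma harmonic_at_right0 (k : R) : 0 < k ->
  (k * n.+1%:R^-1) @[n --> \oo] --> 0^'+.
Proof.
move=> k0; have H : (k * n.+1%:R^-1) @[n --> \oo] --> (0 : R).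
  by rewrite -[X in _ --> X](mulr0 k); apply: cvgM; [exact: cvg_cst|exact: cvg_harmonic].
move=> P [e /= e0 eP]; suff : \forall n \near \oo, P (k * n.+1%:R^-1) by [].
near=> n; have ne : k / n.+1%:R < e by near: n; exact: (cvgr_lt _ H).
by apply: eP; rewrite /= ?sub0r ?normrN ?gtr0_norm ?mulr_gt0.
Unshelve. all: by end_near. Qed.

Lemma near_mul_gt (x k : R) : 0 < k -> \forall n \near \oo, x < k * n.+1%:R.
Proof.
move=> k0; near=> n; rewrite -ltr_pdivrMl//.
rewrite (@lt_le_trans _ _ n%:R)// ?ler_nat//; near: n; exact: nbhs_infty_gtr.
Unshelve. all: by end_near. Qed.

(* The primitive [A] of [a] vanishing at [d] does not vanish at [omega = 0], so it is
   cut off by [chi n], which is 0 for [omega <= 1/(n+1)] and 1 for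
   [omega >= 2/(n+1)].  The error term [W chi' b] equals [- U chi' b'], which the
   strip means of [U] control. *)
Lemma tensor_omega (theta0 R0 : R) U W G : 0 < theta0 ->
  measurable_fun setT U -> measurable_fun setT W -> measurable_fun setT G ->
  mu2.-integrable setT (fun z => (W z * decay z.2)%:E) ->
  mu2.-integrable setT (fun z => (G z * decay z.2)%:E) ->
  (forall z, z.1 <= 0 -> G z = 0) ->
  vanishes_at_omega0 R0 U ->
  (forall c d c' d' a b, 0 < c -> d < theta0 -> R0 < c' ->
    smooth1 a -> csupp c d a -> smooth1 b -> csupp c' d' b ->
    \int[mu2]_z (U z * (a z.1 * derive1 b z.2)) = - \int[mu2]_z (W z * (a z.1 * b z.2))) ->
  (forall c d c' d' a b, 0 < c -> d < theta0 -> R0 < c' ->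
    smooth1 a -> csupp c d a -> smooth1 b -> csupp c' d' b ->
    \int[mu2]_z (U z * (derive1 a z.1 * derive1 b z.2)) =
    \int[mu2]_z (G z * (a z.1 * b z.2))) ->
  forall c d c' d' a b, 0 < c -> d < theta0 -> R0 < c' ->
    smooth1 a -> csupp c d a -> smooth1 b -> csupp c' d' b ->
  \int[mu2]_z (W z * (a z.1 * b z.2)) =
  - \int[mu2]_z (G z * ((primitive a z.1 - primitive a d) * b z.2)).
Proof.
move=> t0 mU mW mG iW iG G0 U0 UW UG c d c' d' a b c0 dt Rc sa acd sb bcd.
have [s [Cs Cs0 [ss s0 s1 s01 sC]]] := @smooth_step R.
have [Cb Cb0 bC] := csupp_decay sb bcd.
have [Ca Ca0 aC] := csupp_bounded sa acd.
have [CA CA0 AC] := primitive_bounded sa acd.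
have sdb := smooth1_derive1 sb; have dbcd := csupp_derive1 bcd.
have [Cdb Cdb0 dbC] := csupp_bounded sdb dbcd.
(* Vanishing right of d keeps the support away from omega = theta0; left of c the value is the
   constant [- primitive a d]. *)
pose A x := primitive a x - primitive a d.
have sA : smooth1 A.
  apply: (smooth1_of_derive (g := a)) => // x.
  have := is_deriveB (is_derive_primitive sa acd x) (is_derive_cst (primitive a d) x 1).
  by rewrite subr0.
have dA : derive1 A = a.
  apply: is_derive_derive1 => x.
  have := is_deriveB (is_derive_primitive sa acd x) (is_derive_cst (primitive a d) x 1).
  by rewrite subr0.
have A_d x : d < x -> A x = 0 by move=> dx; rewrite /A (primitive_ge sa acd (ltW dx)) subrr.
have A_c x : x < c -> A x = - primitive a d.
  by move=> xc; rewrite /A (primitive_lt acd xc) sub0r.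
have AB x : `|A x| <= CA + CA by rewrite (le_trans (ler_normB _ _))// lerD.
pose chi n x := s (n.+1%:R * x + -1).
pose dchi n x := n.+1%:R * derive1 s (n.+1%:R * x + -1).
have schi n : smooth1 (chi n) by exact: smooth1_affine.
have dchiE n : derive1 (chi n) = dchi n.
  by apply: is_derive_derive1 => x; exact: is_derive_affine.
pose phi n x := chi n x * A x.
have sphi n : smooth1 (phi n) by exact: (smooth1M (schi n) sA).
have sdchi n : smooth1 (dchi n).
  by have := smooth1_derive1 (schi n); rewrite (dchiE n).
have phiC n x : `|phi n x| <= Cs * (CA + CA).
  by rewrite normrM; apply: ler_pM => //; have [] := sC (n.+1%:R * x + -1).
have N0 n : 0 < n.+1%:R :> R by [].
have chi0 n x : x < n.+1%:R^-1 -> chi n x = 0.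
  move=> xN; apply: s0; rewrite subr_le0 -ler_pdivlMl// mulr1; exact: ltW.
have chi1 n x : 2 / n.+1%:R <= x -> chi n x = 1.
  move=> xN; apply: s1; rewrite lerBrDr -ler_pdivrMl// mulrC; exact: xN.
have csupp_phi n : csupp n.+1%:R^-1 d (phi n).
  move=> x; rewrite negb_and -!ltNge /phi => /orP[/chi0->|/A_d->].
    by rewrite mul0r.
  by rewrite mulr0.
have dchi0 n x : ~~ (n.+1%:R^-1 <= x <= 2 / n.+1%:R) -> dchi n x = 0.
  move=> xN; rewrite /dchi s01 ?mulr0//; apply: contraNN xN => /andP[].
  rewrite subr_ge0 lerBlDr => h1 h2.
  by rewrite ler_pdivlMr// mulrC -div1r ler_pdivrMr// [_ * n.+1%:R]mulrC h1.
have near_c : \forall n \near \oo, 2 / n.+1%:R < c.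
  by have := near_mul_gt 2 c0; apply: filterS => n; rewrite ltr_pdivrMr.
have near_t : \forall n \near \oo, 2 / n.+1%:R < theta0.
  by have := near_mul_gt 2 t0; apply: filterS => n; rewrite ltr_pdivrMr.
(* On the support of chi' one has x < c, where A is constant; on the support of a the cutoff equals
   1. *)
have dphiE n x : 2 / n.+1%:R < c -> derive1 (phi n) x = - primitive a d * dchi n x + a x.
  move=> nc; have -> : derive1 (phi n) x = chi n x * a x + A x * dchi n x.
    have := is_deriveM (smooth1_is_derive (schi n) x) (smooth1_is_derive sA x).
    by rewrite dA dchiE derive1E => -[_ ->].
  rewrite addrC; congr (_ + _).
    have [/andP[_ xn]|/dchi0->] := boolP (n.+1%:R^-1 <= x <= 2 / n.+1%:R).
      by rewrite A_c// (le_lt_trans xn).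
    by rewrite !mulr0.
  have [/andP[cx _]|/acd->] := boolP (c <= x <= d); last by rewrite mulr0.
  by rewrite chi1 ?mul1r// ltW// (lt_le_trans nc).
have phi1 n x : 2 / n.+1%:R <= x -> phi n x = A x.
  by move=> xn; rewrite /phi (chi1 _ _ xn) mul1r.
have dchiC n x : `|dchi n x| <= n.+1%:R * Cs.
  by rewrite normrM ger0_norm// ler_wpM2l//; have [] := sC (n.+1%:R * x + -1).
have mb : measurable_fun [set: L] b := smooth1_measurableR sb.
have ma : measurable_fun [set: L] a := smooth1_measurableR sa.
have mdchi n : measurable_fun [set: L] (dchi n) := smooth1_measurableR (sdchi n).
clear dchiE schi chi0 chi1; clearbody phi; clearbody dchi; clear chi.
rewrite -[X in _ = - X]/(\int[mu2]_z (G z * (A z.1 * b z.2))); clearbody A.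
(* Both hypotheses are applied to the integral of U phi' b', which links W tested with phi' b to G
   tested with phi b. The part of phi' due to the cutoff is then moved once more from W to U, whose
   trace is known. *)
have eq_n : \forall n \near \oo,
    (- primitive a d) * \int[mu2]_z (U z * (dchi n z.1 * derive1 b z.2)) -
    \int[mu2]_z (G z * (phi n z.1 * b z.2)) = \int[mu2]_z (W z * (a z.1 * b z.2)).
  near=> n.
  have nc : 2 / n.+1%:R < c by near: n.
  have nt : 2 / n.+1%:R < theta0 by near: n.
  have nV0 : 0 < n.+1%:R^-1 :> R by rewrite invr_gt0.
  have := UG _ _ _ _ _ _ nV0 dt Rc (sphi n) (@csupp_phi n) sb bcd.
  rewrite (UW _ _ _ _ _ _ nV0 dt Rc (smooth1_derive1 (sphi n))
    (csupp_derive1 (@csupp_phi n)) sb bcd) => <-.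
  have -> : \int[mu2]_z (U z * (dchi n z.1 * derive1 b z.2)) =
      - \int[mu2]_z (W z * (dchi n z.1 * b z.2)).
    exact: (UW _ _ _ _ _ _ nV0 nt Rc (sdchi n) (@dchi0 n) sb bcd).
  rewrite mulrNN opprK.
  have iWd := integrable_decayM mW iW (mdchi n) mb (dchiC n) bC.
  have iWa := integrable_decayM mW iW ma mb aC bC.
  have -> : \int[mu2]_z (W z * (derive1 (phi n) z.1 * b z.2)) =
      \int[mu2]_z (- primitive a d * (W z * (dchi n z.1 * b z.2)) + W z * (a z.1 * b z.2)).
    by apply: eq_Rintegral => z _; rewrite dphiE//; ring.
  rewrite RintegralD// ?RintegralZl//; first ring.
  by have := integrableZl measurableT (- primitive a d) iWd; apply: eq_integrable.
have U_cvg : \int[mu2]_z (U z * (dchi n z.1 * derive1 b z.2)) @[n --> \oo] --> 0.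
  (* A window strictly above R0 that contains the support of b; the maximum keeps a0 < b0 also when
     d' < c'. *)
  pose a0 := (R0 + c') / 2; pose b0 := Num.max c' d' + 1.
  have Ra0 : R0 < a0 by rewrite /a0; lra.
  have ac' : a0 < c' by rewrite /a0; lra.
  have cb0 : c' < b0 by rewrite /b0 ltr_pwDr// le_max lexx.
  have db0 : d' < b0 by rewrite /b0 ltr_pwDr// le_max lexx orbT.
  pose S (h : R) : set (L * L) := `]0, h[ `*` `]a0, b0[.
  have mS h : measurable (S h) by apply: measurableX; exact: measurable_itv.
  (* The support of chi' reaches up to 2/(n+1) inclusive and the strip is open, so the width 3/(n+1)
     is taken; the bound (n+1) Cs on chi' is then 3 Cs / h, matching the factor 1/h of the strip
     mean. *)
  pose h n : R := 3 * n.+1%:R^-1.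
  pose E n := ((h n)^-1%:E * \int[mu2]_(z in S (h n)) `|U z|%:E)%E.
  have E0 : E n @[n --> \oo] --> 0%E.
    apply: (cvg_comp _ _ (harmonic_at_right0 (ltr0n _ 3)) (U0 a0 b0 Ra0 _)).
    exact: lt_trans cb0.
  have le_E n : (`|\int[mu2]_z (U z * (dchi n z.1 * derive1 b z.2))|%:E <=
      (3 * Cs * Cdb)%:E * E n)%E.
    have mf : measurable_fun setT (fun z : L * L => U z * (dchi n z.1 * derive1 b z.2)).
      by apply: measurable_funM => //; exact: (measurable_tensor (sdchi n) sdb).
    apply: le_trans (abs_Rintegral_le _ mf) _.
    rewrite (@integral_eq_out _ _ (S (h n)))//; last first.
      move=> [x y] _ nS /=.
      have [/andP[xn1 xn2]|/dchi0->] := boolP (n.+1%:R^-1 <= x <= 2 / n.+1%:R); last first.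
        by rewrite mul0r mulr0 normr0.
      rewrite [X in (_ * (_ * X))]dbcd ?mulr0 ?normr0//; apply/negP => /andP[cy yd].
      apply: nS; split; rewrite /= in_itv/=.
        by rewrite (lt_le_trans _ xn1) ?invr_gt0//= (le_lt_trans xn2)// ltr_pM2r ?invr_gt0// ltr_nat.
      by rewrite (lt_le_trans ac' cy) (le_lt_trans yd).
    rewrite /E /h muleA -EFinM -ge0_integralZl//; last 2 first.
    - by apply/measurable_EFinP; apply: measurableT_comp => //; exact: measurable_funTS.
    - by rewrite lee_fin !mulr_ge0// invr_ge0 mulr_ge0// invr_ge0.
    apply: ge0_le_integral => //.
    - by apply: measurableT_comp => //; apply/measurable_EFinP; exact: measurable_funTS.
    - apply: emeasurable_funM; first exact: measurable_cst.
      by apply/measurable_EFinP; apply: measurableT_comp => //; exact: measurable_funTS.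
    move=> z _; rewrite -EFinM lee_fin normrM mulrC ler_wpM2r// normrM.
    rewrite invfM invrK (_ : 3 * Cs * Cdb * _ = n.+1%:R * Cs * Cdb); last by field.
    by apply: ler_pM.
  apply/norm_cvg0P.
  apply: (@fine_cvg R nat \oo _ (fun n => (`|\int[mu2]_z (U z * (dchi n z.1 * derive1 b z.2))|)%:E)).
  apply: (squeeze_cvge (f := cst 0%E) (h := fun n => ((3 * Cs * Cdb)%:E * E n)%E)).
  - by near=> n; rewrite lee_fin normr_ge0 le_E.
  - exact: cvg_cst.
  - rewrite -[X in _ --> X](mule0 (3 * Cs * Cdb)%:E).
    by apply: cvgeZl.
have G_cvg : \int[mu2]_z (G z * (phi n z.1 * b z.2)) @[n --> \oo] -->
    \int[mu2]_z (G z * (A z.1 * b z.2)).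
  have bd n z : `|phi n z.1 * b z.2| <= Cs * (CA + CA) * (Cb * decay z.2).
    by rewrite normrM; apply: ler_pM.
  apply: (@Rintegral_dominated _ _ _ _ _
    (fun z => Cs * (CA + CA) * Cb * `|G z * decay z.2|)).
  - by move=> n; apply: measurable_funM => //; exact: (measurable_tensor (sphi n) sb).
  - by apply: measurable_funM => //; exact: (measurable_tensor sA sb).
  (* For omega > 0 the sequence is eventually constant; for omega <= 0, where phi need not tend to
     A, the factor G vanishes. *)
  - move=> z; have [z0|z0] := leP z.1 0.
      by rewrite G0// mul0r; under eq_fun do rewrite mul0r; exact: cvg_cst.
    apply: cvg_near_cst; near=> n; congr (_ * (_ * _)); rewrite phi1//.
    rewrite ltW// ltr_pdivrMr//; near: n; exact: near_mul_gt.
  - have := integrableZl measurableT (Cs * (CA + CA) * Cb) (integrable_abse iG).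
    by apply: eq_integrable.
  - move=> n z; rewrite [leLHS]normrM [X in _ <= _ * X]normrM (gtr0_norm (decay_gt0 _)) [leRHS]mulrCA.
    by rewrite ler_wpM2l// (le_trans (bd n z))// mulrA.
have H : - primitive a d * \int[mu2]_z (U z * (dchi n z.1 * derive1 b z.2)) -
    \int[mu2]_z (G z * (phi n z.1 * b z.2)) @[n --> \oo] -->
    - primitive a d * 0 - \int[mu2]_z (G z * (A z.1 * b z.2)).
  by apply: cvgB => //; apply: cvgM => //; exact: cvg_cst.
rewrite -[RHS]add0r -(mulr0 (- primitive a d)).
have H2 : (fun=> \int[mu2]_z (W z * (a z.1 * b z.2))) @ \oo -->
    - primitive a d * 0 - \int[mu2]_z (G z * (A z.1 * b z.2)).
  by apply: cvg_trans H; exact: near_eq_cvg.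
exact: (cvg_unique (@Rhausdorff R) (cvg_cst _) H2).
Unshelve. all: by end_near. Qed.

(* Here the primitive of [b] is cut off between [n+1] and [2(n+1)], where the
   derivative of the cutoff is of the order of [decay]. *)
Lemma tensor_rho (theta0 R0 : R) U W G :
  measurable_fun setT U -> measurable_fun setT W -> measurable_fun setT G ->
  mu2.-integrable setT (fun z => (W z * decay z.2)%:E) ->
  mu2.-integrable setT (EFin \o G) ->
  (forall c d c' d' a b, 0 < c -> d < theta0 -> R0 < c' ->
    smooth1 a -> csupp c d a -> smooth1 b -> csupp c' d' b ->
    \int[mu2]_z (U z * (a z.1 * derive1 b z.2)) = - \int[mu2]_z (W z * (a z.1 * b z.2))) ->
  (forall c d c' d' a b, 0 < c -> d < theta0 -> R0 < c' ->
    smooth1 a -> csupp c d a -> smooth1 b -> csupp c' d' b ->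
    \int[mu2]_z (U z * (a z.1 * derive1 (derive1 b) z.2)) =
    \int[mu2]_z (G z * (a z.1 * b z.2))) ->
  forall c d c' d' a b, 0 < c -> d < theta0 -> R0 < c' ->
    smooth1 a -> csupp c d a -> smooth1 b -> csupp c' d' b ->
  \int[mu2]_z (W z * (a z.1 * b z.2)) =
  - \int[mu2]_z (G z * (a z.1 * primitive b z.2)).
Proof.
move=> mU mW mG iW iG UW UG c d c' d' a b c0 dt Rc sa acd sb bcd.
have [s [Cs Cs0 [ss s0 s1 s01 sC]]] := @smooth_step R.
have [Cb Cb0 bC] := csupp_decay sb bcd.
have [Ca Ca0 aC] := csupp_bounded sa acd.
have [CB CB0 BC] := primitive_bounded sb bcd.
have sB := smooth1_primitive sb bcd; have dB := derive1_primitive sb bcd.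
pose eta n y := s (- n.+1%:R^-1 * y + 2).
pose deta n y := - n.+1%:R^-1 * derive1 s (- n.+1%:R^-1 * y + 2).
have seta n : smooth1 (eta n) by exact: smooth1_affine.
have detaE n : derive1 (eta n) = deta n.
  by apply: is_derive_derive1 => x; exact: is_derive_affine.
(* The lower end needs no cutoff: the primitive already vanishes left of c'. *)
pose psi n y := eta n y * primitive b y.
have spsi n : smooth1 (psi n) by exact: (smooth1M (seta n) sB).
have sdeta n : smooth1 (deta n).
  by have := smooth1_derive1 (seta n); rewrite (detaE n).
have psiC n y : `|psi n y| <= Cs * CB.
  by rewrite normrM; apply: ler_pM => //; have [] := sC (- n.+1%:R^-1 * y + 2).
have N0 n : 0 < n.+1%:R :> R by [].
have eta0 n y : 2 * n.+1%:R < y -> eta n y = 0.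
  move=> yN; apply: s0; rewrite mulNr addrC subr_le0 mulrC ler_pdivlMr//; exact: ltW.
have eta1 n y : y <= n.+1%:R -> eta n y = 1.
  move=> yN; apply: s1; rewrite mulNr addrC lerBrDl -lerBrDr mulrC ler_pdivrMr//.
  by rewrite (_ : 2 - 1 = 1 :> R) ?mul1r//; ring.
have csupp_psi n : csupp c' (2 * n.+1%:R) (psi n).
  move=> y; rewrite negb_and -!ltNge /psi => /orP[/(primitive_lt bcd)->|/eta0->].
    by rewrite mulr0.
  by rewrite mul0r.
have deta0 n y : ~~ (n.+1%:R <= y <= 2 * n.+1%:R) -> deta n y = 0.
  move=> yN; rewrite /deta s01 ?mulr0//; apply: contraNN yN => /andP[].
  rewrite mulNr addrC subr_ge0 mulrC ler_pdivrMr// => h2.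
  rewrite lerBlDl -lerBlDr ler_pdivlMr// => h1; apply/andP; split => //.
  by rewrite (le_trans _ h1)// (_ : 2 - 1 = 1 :> R) ?mul1r//; ring.
have near_d : \forall n \near \oo, d' <= n.+1%:R.
  by have := near_mul_gt d' (ltr01 : 0 < 1 :> R); apply: filterS => n; rewrite mul1r => /ltW.
have dpsiE n y : d' <= n.+1%:R -> derive1 (psi n) y = deta n y * primitive b y + b y.
  move=> nd; have -> : derive1 (psi n) y = eta n y * b y + primitive b y * deta n y.
    have := is_deriveM (smooth1_is_derive (seta n) y) (smooth1_is_derive sB y).
    by rewrite dB detaE derive1E => -[_ ->].
  rewrite addrC mulrC; congr (_ + _).
  have [/andP[_ yd]|/bcd->] := boolP (c' <= y <= d'); last by rewrite mulr0.
  by rewrite eta1 ?mul1r// (le_trans yd).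
have mb : measurable_fun [set: L] b := smooth1_measurableR sb.
have ma : measurable_fun [set: L] a := smooth1_measurableR sa.
have sdB n : smooth1 (fun y => deta n y * primitive b y) by exact: (smooth1M (sdeta n) sB).
have psi1 n y : y <= n.+1%:R -> psi n y = primitive b y.
  by move=> yn; rewrite /psi (eta1 _ _ yn) mul1r.
(* On the support of eta' one has 1 <= n+1 <= y <= 2(n+1), so 1 + y <= 3(n+1): this is the origin of
   the constant 3. *)
have detaC n y : `|deta n y * primitive b y| <= 3 * Cs * CB * decay y.
  have [/andP[ny yn]|/deta0->] := boolP (n.+1%:R <= y <= 2 * n.+1%:R); last first.
    by rewrite mul0r normr0 !mulr_ge0// ltW// decay_gt0.
  rewrite normrM mulrAC; apply: ler_pM => //.
  have -> : `|deta n y| = n.+1%:R^-1 * `|derive1 s (- n.+1%:R^-1 * y + 2)|.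
    by rewrite /deta normrM; congr (_ * _); rewrite normrN gtr0_norm// invr_gt0.
  rewrite [leRHS]mulrAC.
  apply: ler_pM => //; rewrite ?invr_ge0//; last by have [] := sC (- n.+1%:R^-1 * y + 2).
  have y0 : 0 < y by exact: lt_le_trans ny.
  rewrite /decay gtr0_norm// ler_pdivlMr ?addr_gt0// mulrC ler_pdivrMr//.
  have : 1 <= n.+1%:R :> R by rewrite ler1n.
  lra.
clear detaE seta eta0 eta1; clearbody psi; clearbody deta; clear eta.
have eq_n : \forall n \near \oo,
    - (\int[mu2]_z (W z * (a z.1 * (deta n z.2 * primitive b z.2)))) -
    \int[mu2]_z (G z * (a z.1 * psi n z.2)) = \int[mu2]_z (W z * (a z.1 * b z.2)).
  near=> n.
  have nd : d' <= n.+1%:R by near: n.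
  have := UG _ _ _ _ _ _ c0 dt Rc sa acd (spsi n) (@csupp_psi n).
  rewrite (UW _ _ _ _ _ _ c0 dt Rc sa acd (smooth1_derive1 (spsi n))
    (csupp_derive1 (@csupp_psi n))) => <-.
  rewrite opprK.
  have iWd := integrable_decayM mW iW ma (smooth1_measurableR (sdB n)) aC (detaC n).
  have iWa := integrable_decayM mW iW ma mb aC bC.
  have -> : \int[mu2]_z (W z * (a z.1 * derive1 (psi n) z.2)) =
      \int[mu2]_z (W z * (a z.1 * (deta n z.2 * primitive b z.2)) + W z * (a z.1 * b z.2)).
    by apply: eq_Rintegral => z _; rewrite dpsiE//; ring.
  by rewrite RintegralD//; ring.
(* Here the error is not turned back into U: it is dominated by a multiple of |W| [decay], which is
   integrable, and at any fixed R it vanishes once n+1 > R. *)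
have W_cvg : \int[mu2]_z (W z * (a z.1 * (deta n z.2 * primitive b z.2))) @[n --> \oo] --> 0.
  have -> : 0 = \int[mu2]_z (0 : R) by rewrite /Rintegral integral0.
  apply: (@Rintegral_dominated _ _ _ _ _
    (fun z => Ca * (3 * Cs * CB) * `|W z * decay z.2|)).
  - move=> n; apply: measurable_funM => //.
    exact: (measurable_tensor sa (sdB n)).
  - exact: measurable_cst.
  - move=> z; apply: cvg_near_cst; near=> n; rewrite deta0 ?mul0r ?mulr0//.
    rewrite negb_and -!ltNge; apply/orP; left; rewrite -[ltRHS]mul1r.
    by near: n; exact: near_mul_gt.
  - have := integrableZl measurableT (Ca * (3 * Cs * CB)) (integrable_abse iW).
    by apply: eq_integrable.
  - move=> n z; rewrite [leLHS]normrM [X in _ <= _ * X]normrM (gtr0_norm (decay_gt0 _)) [leRHS]mulrCA.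
    rewrite ler_wpM2l// normrM -[leRHS]mulrA.
    by apply: ler_pM.
have G_cvg : \int[mu2]_z (G z * (a z.1 * psi n z.2)) @[n --> \oo] -->
    \int[mu2]_z (G z * (a z.1 * primitive b z.2)).
  apply: (@Rintegral_dominated _ _ _ _ _ (fun z => Ca * (Cs * CB) * `|G z|)).
  - by move=> n; apply: measurable_funM => //; exact: (measurable_tensor sa (spsi n)).
  - by apply: measurable_funM => //; exact: (measurable_tensor sa sB).
  - move=> z; apply: cvg_near_cst; near=> n; rewrite psi1//.
    by rewrite ltW// -[ltRHS]mul1r; near: n; exact: near_mul_gt.
  - have := integrableZl measurableT (Ca * (Cs * CB)) (integrable_abse iG).
    by apply: eq_integrable.
  - move=> n z; rewrite normrM [leRHS]mulrC ler_wpM2l// normrM; exact: ler_pM.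
have H : - (\int[mu2]_z (W z * (a z.1 * (deta n z.2 * primitive b z.2)))) -
    \int[mu2]_z (G z * (a z.1 * psi n z.2)) @[n --> \oo] -->
    - 0 - \int[mu2]_z (G z * (a z.1 * primitive b z.2)).
  by apply: cvgB => //; apply: cvgN.
rewrite -[RHS]add0r -oppr0.
have H2 : (fun=> \int[mu2]_z (W z * (a z.1 * b z.2))) @ \oo -->
    - 0 - \int[mu2]_z (G z * (a z.1 * primitive b z.2)).
  by apply: cvg_trans H; exact: near_eq_cvg.
exact: (cvg_unique (@Rhausdorff R) (cvg_cst _) H2).
Unshelve. all: by end_near. Qed.

End cutoffs.

(** * Representation of W almost everywhere by integrals of its derivatives *)

Section representation.
Context {R : realType}.
Notation L := (measurableTypeR R).
Notation mu := (@lebesgue_measure R).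
Notation mu2 := (mu \x mu)%E.
Implicit Types (a b : R -> R) (U W G : L * L -> R).

Definition lt_rel : rel R := fun s t => s < t.
Definition gt_rel : rel R := fun s t => t < s.

Lemma primitive_tail c d a x : smooth1 a -> csupp c d a ->
  primitive a d - primitive a x = \int[mu]_(t in [set t | lt_rel x t]) a t.
Proof.
move=> sa acd.
have ia : mu.-integrable [set` `]-oo, +oo[] (EFin \o a) by apply: csupp_integrable sa acd.
have split y : \int[mu]_(t in [set` `]-oo, +oo[]) a t - primitive a y =
    \int[mu]_(t in `]y, +oo[) a t.
  by rewrite /primitive Rintegral_itvB// ?ltNyr// bnd_simp.
have d0 : \int[mu]_(t in `]d, +oo[) a t = 0.
  rewrite (@eq_Rintegral _ _ _ _ _ (cst 0)); first by rewrite /Rintegral integral0.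
  move=> t; rewrite inE/= in_itv/= andbT => dt; apply: acd.
  by rewrite negb_and -!ltNge dt orbT.
have -> : primitive a d = \int[mu]_(t in [set` `]-oo, +oo[]) a t.
  by have := split d; rewrite d0 => /eqP; rewrite subr_eq0 => /eqP.
rewrite split; congr (Rintegral _ _ _); apply/seteqP; split => t /=; rewrite in_itv/= andbT//.
Qed.

Lemma primitive_headE c d a x : smooth1 a -> csupp c d a ->
  primitive a x = \int[mu]_(t in [set t | gt_rel x t]) a t.
Proof.
move=> sa acd; rewrite /primitive -Rintegral_itv_bndo_bndc; last first.
  by apply: csupp_integrable sa acd.
by congr (Rintegral _ _ _); apply/seteqP; split => t /=; rewrite in_itv.
Qed.

Lemma Rintegral_Omega_tensor (theta0 R0 c d c' d' : R) (f : L * L -> R) a b :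
  0 < c -> d < theta0 -> R0 < c' -> csupp c d a -> csupp c' d' b ->
  \int[plane_measure]_(z in Omega theta0 R0) (f z * (a z.1 * b z.2)) =
  \int[mu2]_z (f z * (a z.1 * b z.2)).
Proof.
move=> c0 dt Rc acd bcd; rewrite /Rintegral; congr fine; symmetry.
apply: integral_eq_out => // -[x y] _ nO /=.
have [/andP[cx xd]|/acd->] := boolP (c <= x <= d); last by rewrite mul0r mulr0.
rewrite [X in (_ * (_ * X))]bcd ?mulr0//; apply/negP => /andP[cy yd]; apply: nO.
rewrite /Omega; split; rewrite /= in_itv/= ?andbT.
  by rewrite (lt_le_trans c0)//= (le_lt_trans xd).
by rewrite (lt_le_trans Rc).
Qed.

Lemma integrable_rectangle (f : L * L -> R) (c d c' d' : R) : measurable_fun setT f ->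
  mu2.-integrable setT (fun z => (f z * (\1_`[c, d] z.1 * \1_`[c', d'] z.2))%:E) ->
  mu2.-integrable (`]c, d[ `*` `]c', d'[) (EFin \o f).
Proof.
move=> mf intf; have mQ : measurable (`]c, d[ `*` `]c', d'[ : set (L * L)).
  by apply: measurableX; exact: measurable_itv.
have := integrableS measurableT mQ (@subsetT _ _) intf.
apply: eq_integrable => // -[x y]; rewrite inE => -[/= xcd ycd] /=.
rewrite !indicE !mem_set ?mulr1//.
  by move: ycd; rewrite /= !in_itv/= => /andP[/ltW-> /ltW->].
by move: xcd; rewrite /= !in_itv/= => /andP[/ltW-> /ltW->].
Qed.

Lemma indic_itv_integrable (c d : R) :
  mu.-integrable [set: L] (EFin \o (\1_`[c, d] : L -> R)).
Proof. exact: integrable_indic_itv. Qed.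

Lemma indic_itv_decay (c d : R) (y : R) :
  `|\1_`[c, d] y| <= (1 + (`|c| + `|d|)) * decay y :> R.
Proof.
rewrite indicE; have [|_] := boolP (_ \in _); last first.
  by rewrite normr0 mulr_ge0 ?addr_ge0// ltW// decay_gt0.
by rewrite inE/= in_itv/= normr1; exact: decay_ge.
Qed.

(** The difference W - V is integrable on bounded rectangles and orthogonal to all products of
    bumps. Integrability is stated against indicators of closed intervals because these dominate the
    bumps. *)
Lemma ae_eq_Omega (theta0 R0 : R) (W V : L * L -> R) :
  measurable_fun setT W -> measurable_fun setT V ->
  (forall c d c' d',
    mu2.-integrable setT (fun z => (W z * (\1_`[c, d] z.1 * \1_`[c', d'] z.2))%:E)) ->
  (forall c d c' d',
    mu2.-integrable setT (fun z => (V z * (\1_`[c, d] z.1 * \1_`[c', d'] z.2))%:E)) ->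
  (forall c d c' d' n, 0 < c -> d < theta0 -> R0 < c' ->
    \int[mu2]_z (W z * (bump c d n z.1 * bump c' d' n z.2)) =
    \int[mu2]_z (V z * (bump c d n z.1 * bump c' d' n z.2))) ->
  {ae mu2, forall z, Omega theta0 R0 z -> W z = V z}.
Proof.
move=> mW mV iW iV WV.
have bb (f : L * L -> R) c d c' d' n : measurable_fun setT f ->
    (mu2.-integrable setT (fun z => (f z * (\1_`[c, d] z.1 * \1_`[c', d'] z.2))%:E)) ->
    mu2.-integrable setT (fun z => (f z * (bump c d n z.1 * bump c' d' n z.2))%:E).
  move=> mf intf; apply: (integrable_bound (C := 1) _ _ intf) => //.
    by apply: measurable_funM => //; apply: measurable_tensor; exact: smooth1_bump.
  move=> -[x y] _ /=; rewrite mul1r normrM [leRHS]normrM ler_wpM2l//.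
  rewrite (normrM (bump c d n x)) [leRHS]normrM.
  have le1 (u v t : R) : `|bump u v n t| <= `|\1_`[u, v] t| :> R.
    rewrite indicE; have [_|] := boolP (t \in _).
      by rewrite normr1 (ger0_norm (bump_ge0 _ _ _ _)) bump_le1.
    rewrite notin_setE/= in_itv/= => tuv.
    by rewrite (@csupp_bump _ u v n t) ?normr0//; exact/negP.
  exact: (ler_pM (normr_ge0 _) (normr_ge0 _) (le1 c d x) (le1 c' d' y)).
have := @ae_eq0_Omega R theta0 R0 (fun z => W z - V z).
move=> H; have {H} : {ae mu2, forall z, Omega theta0 R0 z -> W z - V z = 0}.
  apply: H.
  - by apply: (@measurable_funS _ _ _ _ setT) => //; exact: measurable_funB.
  - move=> c d c' d' _ _ _.
    have i1 := integrable_rectangle mW (iW c d c' d').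
    have i2 := integrable_rectangle mV (iV c d c' d').
    have mQ : measurable (`]c, d[ `*` `]c', d'[ : set (L * L)).
      by apply: measurableX; exact: measurable_itv.
    by have := integrableB mQ i1 i2; apply: eq_integrable.
  - move=> c d c' d' n c0 dt Rc.
    rewrite (Rintegral_Omega_tensor _ c0 dt Rc (@csupp_bump _ c d n) (@csupp_bump _ c' d' n)).
    under eq_Rintegral do rewrite mulrBl.
    rewrite RintegralB//; last 2 first.
    - exact: bb.
    - exact: bb.
    by rewrite WV// subrr.
apply: (@filterS _ _ (ae_filter_ringOfSetsType (@plane_measure R))) => z H /H/eqP.
by rewrite subr_eq0 => /eqP.
Qed.

(** Let A be the primitive of a. Against a product a b, [tensor_omega] turns W into G tested with
    (A(d) - A) b, and [integral_plane_rel] does the same for the tail of G. The two sides agree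
    against all products of bumps, hence almost everywhere. *)
Lemma repr_omega (theta0 R0 : R) U W G : 0 < theta0 ->
  measurable_fun setT U -> measurable_fun setT W -> measurable_fun setT G ->
  mu2.-integrable setT (fun z => (W z * decay z.2)%:E) ->
  mu2.-integrable setT (fun z => (G z * decay z.2)%:E) ->
  (forall z, z.1 <= 0 -> G z = 0) ->
  vanishes_at_omega0 R0 U ->
  (forall c d c' d' a b, 0 < c -> d < theta0 -> R0 < c' ->
    smooth1 a -> csupp c d a -> smooth1 b -> csupp c' d' b ->
    \int[mu2]_z (U z * (a z.1 * derive1 b z.2)) = - \int[mu2]_z (W z * (a z.1 * b z.2))) ->
  (forall c d c' d' a b, 0 < c -> d < theta0 -> R0 < c' ->
    smooth1 a -> csupp c d a -> smooth1 b -> csupp c' d' b ->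
    \int[mu2]_z (U z * (derive1 a z.1 * derive1 b z.2)) =
    \int[mu2]_z (G z * (a z.1 * b z.2))) ->
  {ae mu2, forall z, Omega theta0 R0 z -> W z = plane_tail lt_rel G z}.
Proof.
move=> t0 mU mW mG iW iG G0 U0 UW UG.
have mT : measurable [set z : L * L | lt_rel z.1 z.2] := ndo_measurable (@null_diag_order_lt R).
apply: ae_eq_Omega => //.
- exact: measurable_plane_tail.
- move=> c d c' d'; apply: (integrable_decayM mW iW (C := 1)).
  + exact: measurable_indic.
  + exact: measurable_indic.
  + by move=> x; rewrite indicE; case: (_ \in _); rewrite ?normr1 ?normr0.
  + exact: indic_itv_decay.
- move=> c d c' d'.
  apply: (integrable_plane_tail mT mG decay_gt0 iG (indic_itv_integrable c d)).
  + exact: measurable_indic.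
  + exact: indic_itv_decay.
- move=> c d c' d' n c0 dt Rc.
  have sa := @smooth1_bump R c d n; have acd := @csupp_bump R c d n.
  have sb := @smooth1_bump R c' d' n; have bcd := @csupp_bump R c' d' n.
  rewrite (tensor_omega t0 mU mW mG iW iG G0 U0 UW UG c0 dt Rc sa acd sb bcd).
  have [Cb Cb0 bC] := csupp_decay sb bcd.
  have [CA CA0 AC] := primitive_bounded sa acd.
  have ia : mu.-integrable [set: L] (EFin \o bump c d n).
    exact: (csupp_integrable measurableT sa acd).
  have := @integral_plane_rel R lt_rel G decay mT mG decay_gt0 iG (bump c d n)
    (bump c' d' n) (fun x => primitive (bump c d n) d - primitive (bump c d n) x) Cb (CA + CA) ia.
  move=> /(_ (smooth1_measurableR sb) bC (fun x => primitive_tail x sa acd)).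
  have mA : measurable_fun [set: L] (fun x => primitive (bump c d n) d - primitive (bump c d n) x).
    apply: measurable_funB; first exact: measurable_cst.
    exact: (smooth1_measurableR (smooth1_primitive sa acd)).
  move=> /(_ mA) H; rewrite [RHS]/Rintegral -H; last first.
    by move=> x; rewrite (le_trans (ler_normB _ _))// lerD.
  have ACx x : `|primitive (bump c d n) x - primitive (bump c d n) d| <= CA + CA.
    by rewrite (le_trans (ler_normB _ _))// lerD.
  have mA' : measurable_fun [set: L] (fun x => primitive (bump c d n) x - primitive (bump c d n) d).
    apply: measurable_funB; last exact: measurable_cst.
    exact: (smooth1_measurableR (smooth1_primitive sa acd)).
  have iGA := integrable_decayM mG iG mA' (smooth1_measurableR sb) ACx bC.
  rewrite -mulN1r -RintegralZl//; apply: eq_Rintegral => z _; ring.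
Qed.

(** As in the omega direction, with the coordinates exchanged by [swap] because [plane_tail]
    integrates the first one, and with the weight 1 since G itself is integrable. The minus sign
    comes from integrating back from infinity. *)
Lemma repr_rho (theta0 R0 : R) U W G :
  measurable_fun setT U -> measurable_fun setT W -> measurable_fun setT G ->
  mu2.-integrable setT (fun z => (W z * decay z.2)%:E) ->
  mu2.-integrable setT (EFin \o G) ->
  (forall c d c' d' a b, 0 < c -> d < theta0 -> R0 < c' ->
    smooth1 a -> csupp c d a -> smooth1 b -> csupp c' d' b ->
    \int[mu2]_z (U z * (a z.1 * derive1 b z.2)) = - \int[mu2]_z (W z * (a z.1 * b z.2))) ->
  (forall c d c' d' a b, 0 < c -> d < theta0 -> R0 < c' ->
    smooth1 a -> csupp c d a -> smooth1 b -> csupp c' d' b ->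
    \int[mu2]_z (U z * (a z.1 * derive1 (derive1 b) z.2)) =
    \int[mu2]_z (G z * (a z.1 * b z.2))) ->
  {ae mu2, forall z, Omega theta0 R0 z ->
    W z = - plane_tail gt_rel (G \o swap) (swap z)}.
Proof.
move=> mU mW mG iW iG UW UG.
have mT : measurable [set z : L * L | gt_rel z.1 z.2] := ndo_measurable (@null_diag_order_gt R).
have mGs : measurable_fun setT (G \o swap) by exact: measurableT_comp measurable_swapf.
have iGs : mu2.-integrable setT (fun z => ((G \o swap) z * cst 1 z.2)%:E).
  by have := integrable_swap iG; apply: eq_integrable => // z _; rewrite /= mulr1.
have c10 (y : L) : 0 < cst 1 y :> R by [].
have m1 : measurable_fun [set: L] (cst 1 : L -> R) by exact: measurable_cst.
have mPT := measurable_plane_tail mT mGs.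
have ab1 (b : R -> R) C : (forall x, `|b x| <= C) -> forall x, `|b x| <= C * cst 1 x.
  by move=> bC x; rewrite mulr1.
apply: ae_eq_Omega => //.
- by apply: measurableT_comp => //; exact: measurableT_comp measurable_swapf.
- move=> c d c' d'; apply: (integrable_decayM mW iW (C := 1)).
  + exact: measurable_indic.
  + exact: measurable_indic.
  + by move=> x; rewrite indicE; case: (_ \in _); rewrite ?normr1 ?normr0.
  + exact: indic_itv_decay.
- move=> c d c' d'.
  have := @integrable_plane_tail R gt_rel (G \o swap) (cst 1) mT mGs c10 iGs
    (\1_`[c', d']) (\1_`[c, d]) 1 (indic_itv_integrable c' d') (measurable_indic (measurable_itv _)).
  have ind1 x : `|\1_`[c, d] x| <= 1 * cst 1 x :> R.
    by rewrite mulr1 indicE; case: (_ \in _); rewrite ?normr1 ?normr0.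
  move=> /(_ ind1) /integrable_swap /(integrableN).
  by apply: eq_integrable => // z _ /=; rewrite mulNr [(\1__ z.2 * _)]mulrC.
- move=> c d c' d' n c0 dt Rc.
  have sa := @smooth1_bump R c d n; have acd := @csupp_bump R c d n.
  have sb := @smooth1_bump R c' d' n; have bcd := @csupp_bump R c' d' n.
  rewrite (tensor_rho mU mW mG iW iG UW UG c0 dt Rc sa acd sb bcd).
  have [CB CB0 BC] := primitive_bounded sb bcd.
  have [Ca Ca0 aC] := csupp_bounded sa acd.
  have ib : mu.-integrable [set: L] (EFin \o bump c' d' n).
    exact: (csupp_integrable measurableT sb bcd).
  have mB : measurable_fun [set: L] (primitive (bump c' d' n)).
    exact: (smooth1_measurableR (smooth1_primitive sb bcd)).
  have H := @integral_plane_rel R gt_rel (G \o swap) (cst 1) mT mGs c10 iGs (bump c' d' n)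
    (bump c d n) (primitive (bump c' d' n)) Ca CB ib (smooth1_measurableR sa) (ab1 _ _ aC)
    (fun x => primitive_headE x sb bcd) mB BC.
  have iP := @integrable_plane_tail R gt_rel (G \o swap) (cst 1) mT mGs c10 iGs
    (bump c' d' n) (bump c d n) Ca ib (smooth1_measurableR sa) (ab1 _ _ aC).
  have iL : mu2.-integrable setT
      (fun z : L * L => ((G \o swap) z * (primitive (bump c' d' n) z.1 * bump c d n z.2))%:E).
    apply: (integrable_bound (C := CB * Ca) _ _ (integrable_swap iG)) => //.
      apply: measurable_funM => //.
      exact: (measurable_tensor (smooth1_primitive sb bcd) sa).
    move=> z _; rewrite normrM mulrC ler_wpM2r// normrM.
    exact: (ler_pM (normr_ge0 _) (normr_ge0 _) (BC _) (aC _)).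
  have := integral_swap iP; rewrite -H -(integral_swap iL) => HH.
  have iPs := integrable_swap iP.
  rewrite -mulN1r.
  transitivity (-1 * \int[mu2]_z (plane_tail gt_rel (G \o swap) (swap z) *
     (bump c' d' n z.2 * bump c d n z.1))).
    congr (_ * _); rewrite /Rintegral; congr fine.
    transitivity (\int[mu2]_z ((G \o swap) (swap z) *
        (primitive (bump c' d' n) (swap z).1 * bump c d n (swap z).2))%:E)%E.
      by apply: eq_integral => -[x y] _; rewrite /swap/=; congr EFin; rewrite [X in _ * X]mulrC.
    by rewrite -HH.
  rewrite -RintegralZl//; apply: eq_Rintegral => z _; ring.
Qed.

End representation.

(** * The interpolation inequality *)

Section ladyzhenskaya.
Context {R : realType}.
Notation L := (measurableTypeR R).
Notation mu := (@lebesgue_measure R).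
Notation mu2 := (mu \x mu)%E.
Local Open Scope ereal_scope.

Lemma tail_sqr_le (T : rel R) (h : L -> R) (x : R) : null_diag_order T ->
  mu.-integrable setT (EFin \o h) ->
  (tail T h x ^+ 2)%:E <= \int[mu]_(s in [set s | T s x]) (2 * `|h s * tail T h s|)%:E.
Proof.
move=> oT ih; have mT := ndo_measurable oT; have mD := measurable_section2 x mT.
rewrite tail_sqr//.
have mT' := measurable_converse mT.
have it := @integrable_rel _ (fun s t => T t s) h h mT' ih ih.
have mt := measurable_int _ it.
have mtD : measurable_fun [set s : L | T s x] (fun s => (h s * tail T h s)%:E).
  exact: measurable_funS mt.
have mat : measurable_fun [set s : L | T s x] (fun s => `|(h s * tail T h s)%:E|).
  exact: measurableT_comp.
under [leRHS]eq_integral do rewrite EFinM.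
rewrite ge0_integralZl//; apply: lee_wpmul2l => //.
by apply: (le_trans (lee_abs _)); exact: le_abse_integral.
Qed.

Lemma integral_snd_fst_mul (f g : L -> \bar R) :
  measurable_fun setT f -> measurable_fun setT g ->
  (forall y, 0 <= f y) -> (forall x, 0 <= g x) ->
  (\int[mu]_y f y) * (\int[mu]_x g x) = \int[mu2]_z (f z.2 * g z.1).
Proof.
move=> mf mg f0 g0; have h0 (z : L * L) : 0 <= f z.2 * g z.1 by exact: mule_ge0.
have mh : measurable_fun setT (fun z : L * L => f z.2 * g z.1).
  apply: emeasurable_funM; first exact: (measurableT_comp mf measurable_snd).
  exact: (measurableT_comp mg measurable_fst).
rewrite (fubini_tonelli1 _ mh h0) -ge0_integralZl//; last exact: integral_ge0.
by apply: eq_integral => x _; rewrite /fubini_F /= ge0_integralZr.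
Qed.

Variables (theta0 R0 : R) (W G1 G2 : L * L -> R) (p q : L -> R).
Hypothesis mW : measurable_fun setT W.
Hypothesis mG1 : measurable_fun setT G1.
Hypothesis mG2 : measurable_fun setT G2.
Hypothesis iG1 : mu2.-integrable setT (fun z => (G1 z * decay z.2)%:E).
Hypothesis iG2 : mu2.-integrable setT (EFin \o G2).
Hypothesis G1_out : forall z, ~ Omega theta0 R0 z -> G1 z = 0%R.
Hypothesis G2_out : forall z, ~ Omega theta0 R0 z -> G2 z = 0%R.
Hypothesis W_omega :
  {ae mu2, forall z, Omega theta0 R0 z -> W z = plane_tail lt_rel G1 z}.
Hypothesis W_rho :
  {ae mu2, forall z, Omega theta0 R0 z -> W z = (- plane_tail gt_rel (G2 \o swap) (swap z))%R}.
Hypothesis mp : measurable_fun setT p.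
Hypothesis mq : measurable_fun setT q.
Hypothesis p0 : forall y, (0 <= p y)%R.
Hypothesis q0 : forall y, (0 <= q y)%R.
Hypothesis q_mono : forall y s, (R0 < y)%R -> (y <= s)%R -> (q y <= q s)%R.

Let mlt : measurable [set z : L * L | lt_rel z.1 z.2] := ndo_measurable (@null_diag_order_lt R).
Let mgt : measurable [set z : L * L | gt_rel z.1 z.2] := ndo_measurable (@null_diag_order_gt R).
Let W1 := plane_tail lt_rel G1.
Let W2 (z : L * L) := plane_tail gt_rel (G2 \o swap) (swap z).
Let mG2s : measurable_fun setT (G2 \o swap) := measurableT_comp mG2 measurable_swapf.
Let mW1 : measurable_fun setT W1 := measurable_plane_tail mlt mG1.
Let mW2 : measurable_fun setT W2 :=
  measurableT_comp (measurable_plane_tail mgt mG2s) measurable_swapf.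

Let Phi1 (z : L * L) : \bar R := (2 * (p z.2 * `|G1 z * W1 z|))%:E.
Let Phi2 (z : L * L) : \bar R := (2 * (q z.2 * `|G2 z * W2 z|))%:E.

Let mPhi1 : measurable_fun setT Phi1.
Proof.
apply/measurable_EFinP; apply: measurable_funM => //; apply: measurable_funM.
  exact: (measurableT_comp mp measurable_snd).
by apply: measurableT_comp => //; exact: measurable_funM.
Qed.

Let mPhi2 : measurable_fun setT Phi2.
Proof.
apply/measurable_EFinP; apply: measurable_funM => //; apply: measurable_funM.
  exact: (measurableT_comp mq measurable_snd).
by apply: measurableT_comp => //; exact: measurable_funM.
Qed.

Let Phi1_ge0 z : 0 <= Phi1 z. Proof. by rewrite lee_fin !mulr_ge0. Qed.
Let Phi2_ge0 z : 0 <= Phi2 z. Proof. by rewrite lee_fin !mulr_ge0. Qed.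

(** Integrating over full lines makes F1 a function of R only and F2 a function of omega only, so
    that the integral of their product factors. *)
Let F1 y := \int[mu]_x Phi1 (x, y).
Let F2 x := \int[mu]_y Phi2 (x, y).

Let mF1 : measurable_fun setT F1.
Proof. exact: (measurable_fun_fubini_tonelli_G Phi1). Qed.
Let mF2 : measurable_fun setT F2.
Proof. exact: (measurable_fun_fubini_tonelli_F Phi2). Qed.

Let F1_ge0 y : 0 <= F1 y. Proof. exact: integral_ge0. Qed.
Let F2_ge0 x : 0 <= F2 x. Proof. exact: integral_ge0. Qed.

Let W1_le : {ae mu, forall y, forall x, (p y * W1 (x, y) ^+ 2)%:E <= F1 y}.
Proof.
have := ae_slice mG1 decay_gt0 iG1; apply: filterS => y iGy x.
have H := tail_sqr_le x (@null_diag_order_lt R) iGy.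
rewrite EFinM; apply: (le_trans (lee_wpmul2l _ H)); first by rewrite lee_fin.
have mD : measurable [set s : L | lt_rel s x] by exact: (measurable_section2 x mlt).
have m1 : measurable_fun setT (fun s : L => (2 * `|G1 (s, y) * W1 (s, y)|)%:E).
  apply/measurable_EFinP; apply: measurable_funM => //; apply: measurableT_comp => //.
  apply: measurable_funM; first exact: (measurableT_comp mG1 (pair2_measurable y)).
  exact: (measurableT_comp mW1 (pair2_measurable y)).
rewrite -ge0_integralZl//; last 2 first.
- exact: measurable_funS m1.
- by rewrite lee_fin.
apply: (@le_trans _ _ (\int[mu]_(s in [set s : L | lt_rel s x]) Phi1 (s, y))).
  rewrite le_eqVlt; apply/orP; left; apply/eqP; apply: eq_integral => s _.
  by rewrite /Phi1 -EFinM; congr EFin; rewrite /W1 /plane_tail/= mulrCA.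
apply: ge0_subset_integral => //.
exact: (measurableT_comp mPhi1 (pair2_measurable y)).
Qed.

(** The tail runs over s > y, where monotonicity replaces q(y) by the larger q(s) under the integral
    sign. *)
Let W2_le : {ae mu, forall x, forall y, (R0 < y)%R ->
  (q y * W2 (x, y) ^+ 2)%:E <= F2 x}.
Proof.
have iGs : mu2.-integrable setT (fun z => ((G2 \o swap) z * cst 1%R z.2)%:E).
  by have := integrable_swap iG2; apply: eq_integrable => // z _; rewrite /= mulr1.
have := ae_slice mG2s (fun=> ltr01) iGs; apply: filterS => x iGx y Ry.
have H := tail_sqr_le y (@null_diag_order_gt R) iGx.
rewrite EFinM; apply: (le_trans (lee_wpmul2l _ H)); first by rewrite lee_fin.
have mD : measurable [set s : L | gt_rel s y] by exact: (measurable_section2 y mgt).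
have m1 : measurable_fun setT (fun s : L => (2 * `|G2 (x, s) * W2 (x, s)|)%:E).
  apply/measurable_EFinP; apply: measurable_funM => //; apply: measurableT_comp => //.
  apply: measurable_funM; first exact: (measurableT_comp mG2 (pair1_measurable x)).
  exact: (measurableT_comp mW2 (pair1_measurable x)).
rewrite -ge0_integralZl//; last 2 first.
- exact: measurable_funS m1.
- by rewrite lee_fin.
have mP : measurable_fun setT (fun s : L => Phi2 (x, s)).
  exact: (measurableT_comp mPhi2 (pair1_measurable x)).
apply: (@le_trans _ _ (\int[mu]_(s in [set s : L | gt_rel s y]) Phi2 (x, s))).
  apply: ge0_le_integral => //.
  - by move=> s _; rewrite -EFinM lee_fin !mulr_ge0.
  - by apply: emeasurable_funM; [exact: measurable_cst|exact: measurable_funS m1].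
  - exact: measurable_funS mP.
  move=> s /= ys; rewrite -EFinM lee_fin mulrCA ler_wpM2l//.
  by rewrite ler_wpM2r// q_mono// ltW.
by apply: ge0_subset_integral.
Qed.

(** A weighted Ladyzhenskaya inequality: each representation accounts for one factor W^2, and the
    resulting bounds depend on separate variables. *)
Lemma ladyzhenskaya :
  \int[mu2]_(z in Omega theta0 R0) (`|W z| ^+ 4 * (p z.2 * q z.2))%:E <=
  (\int[mu2]_(z in Omega theta0 R0) (2 * (p z.2 * `|G1 z * W z|))%:E) *
  (\int[mu2]_(z in Omega theta0 R0) (2 * (q z.2 * `|G2 z * W z|))%:E).
Proof.
have mO : measurable (Omega theta0 R0 : set (L * L)).
  by apply: measurableX; exact: measurable_itv.
have intPhi1 : \int[mu2]_(z in Omega theta0 R0) (2 * (p z.2 * `|G1 z * W z|))%:E = \int[mu]_y F1 y.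
  rewrite -(fubini_tonelli2 Phi1)// [RHS](@integral_eq_out _ _ (Omega theta0 R0))//; last first.
    by move=> z _ /G1_out Gz; rewrite /Phi1 Gz mul0r normr0 !mulr0.
  apply: ae_eq_integral => //.
  - apply: (@measurable_funS _ _ _ _ setT) => //; apply/measurable_EFinP.
    apply: measurable_funM => //; apply: measurable_funM.
      exact: (measurableT_comp mp measurable_snd).
    by apply: measurableT_comp => //; exact: measurable_funM.
  - exact: measurable_funS mPhi1.
  apply: (@filterS _ _ (ae_filter_ringOfSetsType (@plane_measure R)) _ _ _ W_omega).
  by move=> z H Oz; rewrite /Phi1 /W1 H.
have intPhi2 : \int[mu2]_(z in Omega theta0 R0) (2 * (q z.2 * `|G2 z * W z|))%:E = \int[mu]_x F2 x.
  rewrite -(fubini_tonelli1 Phi2)// [RHS](@integral_eq_out _ _ (Omega theta0 R0))//; last first.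
    by move=> z _ /G2_out Gz; rewrite /Phi2 Gz mul0r normr0 !mulr0.
  apply: ae_eq_integral => //.
  - apply: (@measurable_funS _ _ _ _ setT) => //; apply/measurable_EFinP.
    apply: measurable_funM => //; apply: measurable_funM.
      exact: (measurableT_comp mq measurable_snd).
    by apply: measurableT_comp => //; exact: measurable_funM.
  - exact: measurable_funS mPhi2.
  apply: (@filterS _ _ (ae_filter_ringOfSetsType (@plane_measure R)) _ _ _ W_rho).
  by move=> z H Oz; rewrite /Phi2 /W2 H// mulrN normrN.
rewrite intPhi1 intPhi2.
pose H (z : L * L) := F1 z.2 * F2 z.1.
have mH : measurable_fun setT H.
  apply: emeasurable_funM; first exact: (measurableT_comp mF1 measurable_snd).
  exact: (measurableT_comp mF2 measurable_fst).
have H0 z : 0 <= H z := mule_ge0 (F1_ge0 z.2) (F2_ge0 z.1).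
have -> : (\int[mu]_y F1 y) * (\int[mu]_x F2 x) = \int[mu2]_z H z.
  exact: integral_snd_fst_mul.
apply: (@le_trans _ _ (\int[mu2]_(z in Omega theta0 R0) H z)); last first.
  exact: ge0_subset_integral.
apply: ae_ge0_le_integral => //.
- by move=> z _; rewrite lee_fin !mulr_ge0.
- apply: (@measurable_funS _ _ _ _ setT) => //; apply/measurable_EFinP.
  apply: measurable_funM.
    by apply: measurable_funX; exact: measurableT_comp.
  apply: measurable_funM; first exact: (measurableT_comp mp measurable_snd).
  exact: (measurableT_comp mq measurable_snd).
- exact: measurable_funS mH.
(* The slice bounds fail only on null sets of the line, and the cylinders over these are null in the
   plane. *)
have A1 := ae_plane_snd W1_le; have A2 := ae_plane_fst W2_le.
have fl := ae_filter_ringOfSetsType (@plane_measure R).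
apply: (@filterS2 _ _ fl _ _ _ _ (@filterI _ _ fl _ _ A1 A2) (@filterI _ _ fl _ _ W_omega W_rho)).
move=> [x y] [/= H1 H2] [/= V1 V2] Oz.
have Ry : (R0 < y)%R by case: Oz => _ /=; rewrite in_itv/= andbT.
have -> : (`|W (x, y)| ^+ 4 * (p y * q y))%:E =
    (p y * W1 (x, y) ^+ 2)%:E * (q y * W2 (x, y) ^+ 2)%:E.
  rewrite -EFinM; congr EFin.
  rewrite -[W2 _]opprK -[(- W2 _)%R]V2// -[W1 _]V1// sqrrN.
  have -> : (`|W (x, y)| ^+ 4 = (W (x, y) ^+ 2) ^+ 2)%R.
    by rewrite -(real_normK (num_real (W (x, y)))) -exprM.
  ring.
apply: lee_pmul; [by rewrite lee_fin mulr_ge0 ?sqr_ge0..|exact: H1|exact: H2].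
Qed.

End ladyzhenskaya.

(** * The estimate for one component of the velocity *)

Section gradient_estimate.
Context {R : realType}.
Notation L := (measurableTypeR R).
Notation mu := (@lebesgue_measure R).
Notation mu2 := (mu \x mu)%E.

Lemma weak_derivative_is (theta0 R0 : R) i j (u : R * R -> R) :
  (exists g, is_weak_derivative theta0 R0 i j u g) ->
  is_weak_derivative theta0 R0 i j u (weak_derivative theta0 R0 i j u).
Proof. exact: (@xgetPex _ (fun=> 0) [set g | is_weak_derivative theta0 R0 i j u g]). Qed.

Lemma cauchy_schwarz (f g : L * L -> R) :
  measurable_fun setT f -> measurable_fun setT g ->
  (\int[mu2]_z (`|f z * g z|)%:E <=
   (\int[mu2]_z (f z ^+ 2)%:E) `^ 2^-1 * (\int[mu2]_z (g z ^+ 2)%:E) `^ 2^-1)%E.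
Proof.
move=> mf mg; have := @hoelder _ (L * L)%type R mu2 f g 2 2 mf mg.
have h2 : 2^-1 + 2^-1 = 1 :> R by lra.
move=> /(_ (ltr0n _ 2) (ltr0n _ 2) h2); rewrite Lnorm1 !unlock/=.
have E2 (h : L * L -> R) : (\int[mu2]_x (`|(h x)%:E| `^ 2) = \int[mu2]_x (h x ^+ 2)%:E)%E.
  apply: eq_integral => z _; rewrite poweR_EFin; congr EFin.
  by rewrite (powR_mulrn 2 (normr_ge0 _)) real_normK ?num_real.
by rewrite !E2.
Qed.

(** The half-line is enough because R > R0 > 0 on Omega. *)
Lemma integrable_inv_oneDsqr :
  mu.-integrable [set: L] (EFin \o ((fun y : L => (1 + y ^+ 2)^-1) \_ `[0, +oo[)).
Proof.
have mI : measurable (`[0, +oo[ : set L) by exact: measurable_itv.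
have m1 : measurable_fun (`[0, +oo[ : set L) (fun y : L => (1 + y ^+ 2)^-1).
  apply: (@measurable_funS _ _ _ _ setT) => //.
  apply: continuous_measurable_fun; exact: (@continuous_oneDsqrV R).
rewrite (_ : EFin \o _ = (EFin \o (fun y : L => (1 + y ^+ 2)^-1)) \_ `[0, +oo[); last first.
  by apply/funext => y; rewrite /= !patchE; case: ifP.
apply/(integrable_mkcond _ mI).1; apply/integrableP; split; first exact/measurable_EFinP.
have := @integral0y_oneDsqr R; rewrite /oneDsqr => H.
under eq_integral => y _.
  rewrite (_ : `|_|%E = (1 + y ^+ 2)^-1%:E); last first.
    by rewrite gee0_abs//= lee_fin invr_ge0 addr_ge0// sqr_ge0.
  over.
by rewrite H ltry.
Qed.

Variables (theta0 R0 delta eps : R).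
Hypothesis theta0_gt0 : 0 < theta0.
Hypothesis R0_gt0 : 0 < R0.
Hypothesis delta_ge : 2^-1 <= delta.
Hypothesis eps_gt0 : 0 < eps.

Let delta_ge0 : 0 <= delta.
Proof. by apply: le_trans delta_ge; rewrite invr_ge0. Qed.

Let Om : set (L * L) := Omega theta0 R0.
Let r (y : L) : R := rcoord R0 eps y.

Lemma measurable_Omega : measurable Om.
Proof. by apply: measurableX; exact: measurable_itv. Qed.
Let mOm := measurable_Omega.

Lemma rcoord_ge y : R0 < y -> R0 <= r y.
Proof. by move=> Ry; rewrite /r /rcoord lerDl mulr_ge0 ?sqrtr_ge0// subr_ge0 ltW. Qed.

Lemma rcoord_gt0 y : R0 < y -> 0 < r y.
Proof. by move=> /rcoord_ge; exact: lt_le_trans. Qed.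

Lemma rcoord_mono y s : y <= s -> r y <= r s.
Proof. by move=> ys; rewrite /r /rcoord lerD2l ler_wpM2l ?sqrtr_ge0// lerD2r. Qed.

Lemma Omega2 z : Om z -> R0 < z.2.
Proof. by case=> _ /=; rewrite in_itv/= andbT. Qed.

Lemma measurable_rcoord : measurable_fun [set: L] r.
Proof.
apply: measurable_funD; first exact: measurable_cst.
apply: measurable_funM; first exact: measurable_cst.
by apply: measurable_funB; [exact: measurable_id|exact: measurable_cst].
Qed.

Lemma measurable_rpow k : measurable_fun [set: L] (fun y => r y `^ k).
Proof. exact: (measurableT_comp (measurable_powR k) measurable_rcoord). Qed.

Lemma measurable_rpow2 k (D : set (L * L)) : measurable_fun D (fun z : L * L => r z.2 `^ k).
Proof.
apply: (@measurable_funS _ _ _ _ setT) => //.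
exact: (measurableT_comp (measurable_rpow k) measurable_snd).
Qed.

Lemma Rintegral_patch (f k : L * L -> R) :
  \int[plane_measure]_(z in Omega theta0 R0) (f z * k z) = \int[mu2]_z ((f \_ Om) z * k z).
Proof.
rewrite Rintegral_mkcond; apply: eq_Rintegral => z _.
by rewrite !patchE; case: ifP => // _; rewrite mul0r.
Qed.

Lemma measurable_patch (f : L * L -> R) : measurable_fun Om f ->
  measurable_fun setT (f \_ Om).
Proof. by move=> mf; exact: (measurable_restrictT f mOm).1 mf. Qed.

Lemma patch_out (f : L * L -> R) z : ~ Om z -> (f \_ Om) z = 0.
Proof. by move=> nO; rewrite patchE memNset. Qed.

Lemma patch_in (f : L * L -> R) z : Om z -> (f \_ Om) z = f z.
Proof. by move=> nO; rewrite patchE mem_set. Qed.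

Lemma le_integral_Omega (F G : L * L -> R) : measurable_fun setT F ->
  measurable_fun Om G -> (forall z, 0 <= F z) -> (forall z, ~ Om z -> F z = 0) ->
  (forall z, Om z -> F z <= G z) ->
  (\int[mu2]_z (F z)%:E <= \int[mu2]_(z in Om) (G z)%:E)%E.
Proof.
move=> mF mG F0 Fout FG.
rewrite (@integral_eq_out _ _ Om)//; last by move=> z _ /Fout ->.
apply: ge0_le_integral => //.
- by move=> z _; rewrite lee_fin.
- by apply/measurable_EFinP; exact: measurable_funS mF.
- exact/measurable_EFinP.
Qed.

(** Omega has bounded width in omega, so the term 1/(1 + R^2) is integrable on it. The pointwise
    bound comes from Young's inequality in each use. *)
Lemma integrable_square_decay (F S : L * L -> R) (k : L -> R) (C : R) :
  measurable_fun setT F -> measurable_fun setT S -> measurable_fun setT k ->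
  (forall z, 0 <= S z) -> (\int[mu2]_z (S z)%:E < +oo)%E ->
  (forall z, ~ Om z -> F z = 0) ->
  (forall z, Om z -> `|F z| * k z.2 <= C * S z + (1 + z.2 ^+ 2)^-1) ->
  (forall y, 0 <= k y) -> 0 <= C ->
  mu2.-integrable setT (fun z => (F z * k z.2)%:E).
Proof.
move=> mF mS mk S0 Soo Fout Fle k0 C0.
have iS : mu2.-integrable setT (fun z => (C * S z)%:E).
  have : mu2.-integrable setT (EFin \o S).
    apply/integrableP; split; first exact/measurable_EFinP.
    by under eq_integral do rewrite gee0_abs ?lee_fin//.
  by move=> /(integrableZl measurableT C); apply: eq_integrable.
have iI : mu.-integrable [set: L] (EFin \o (\1_`]0, theta0[ : L -> R)).
  exact: integrable_indic_itv.
have iD := integrable_prodM iI integrable_inv_oneDsqr.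
apply: (le_integrable measurableT _ _ (integrableD measurableT iS iD)).
  apply/measurable_EFinP; apply: measurable_funM => //.
  exact: (measurableT_comp mk measurable_snd).
move=> z _; rewrite -[X in (_ <= `|X|)%E]EFinD -[X in (X <= _)%E]/(`|F z * k z.2|%:E).
rewrite -[X in (_ <= X)%E]/(`|C * S z + _|%:E) lee_fin.
have [Oz|nO] := pselect (Om z); last first.
  by rewrite (Fout _ nO) mul0r normr0.
rewrite normrM (ger0_norm (k0 _)) (le_trans (Fle z Oz))// (le_trans _ (ler_norm _))//.
have [zx zy] := Oz; rewrite lerD2l indicE mem_set// mul1r patchE mem_set//=.
by rewrite in_itv/= andbT (le_trans (ltW R0_gt0))// ltW// Omega2.
Qed.

Lemma rpow_ge k y : 0 <= k -> R0 < y -> R0 `^ k <= r y `^ k.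
Proof.
move=> k0 Ry; apply: ge0_ler_powR => //; rewrite ?nnegrE ?(ltW R0_gt0)//.
  exact: ltW (rcoord_gt0 Ry).
exact: rcoord_ge.
Qed.

Lemma rpowD e1 e2 y : R0 < y -> r y `^ (e1 + e2) = r y `^ e1 * r y `^ e2.
Proof.
by move=> Ry; apply: powRD; apply/implyP => _; rewrite gt_eqF// rcoord_gt0.
Qed.

(** Cauchy-Schwarz after splitting the weight into r^e1 and r^e2. The squared weights are written
    [e1 + e1] and [e2 + e2] so that halved exponents recombine by [splitr]. *)
Lemma cs_Omega (F G : L * L -> R) (e1 e2 : R) :
  measurable_fun setT F -> measurable_fun setT G ->
  (forall z, ~ Om z -> F z = 0) ->
  (\int[mu2]_(z in Om) (2 * (r z.2 `^ (e1 + e2) * `|G z * F z|))%:E <=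
   2%:E * ((\int[mu2]_z (F z ^+ 2 * r z.2 `^ (e1 + e1))%:E) `^ 2^-1 *
           (\int[mu2]_z (G z ^+ 2 * r z.2 `^ (e2 + e2))%:E) `^ 2^-1))%E.
Proof.
move=> mF mG F0; pose G' := G \_ Om.
have mG' : measurable_fun setT G'.
  by apply: measurable_patch; exact: measurable_funS mG.
pose f z := F z * r z.2 `^ e1; pose g z := G' z * r z.2 `^ e2.
have mf : measurable_fun setT f by apply: measurable_funM => //; exact: measurable_rpow2.
have mg : measurable_fun setT g by apply: measurable_funM => //; exact: measurable_rpow2.
have -> : (\int[mu2]_(z in Om) (2 * (r z.2 `^ (e1 + e2) * `|G z * F z|))%:E =
    2%:E * \int[mu2]_z (`|f z * g z|)%:E)%E.
  rewrite -ge0_integralZl//; last first.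
    by apply/measurable_EFinP; apply: measurableT_comp => //; exact: measurable_funM.
  rewrite [RHS](@integral_eq_out _ _ Om)//; last first.
    by move=> z _ /F0 Fz; rewrite /f Fz !mul0r normr0 mule0.
  apply: eq_integral => z; rewrite inE => Oz; rewrite -EFinM; congr EFin; congr (2 * _).
  rewrite rpowD; last exact: Omega2.
  rewrite /f /g /G' patch_in// !normrM !(ger0_norm (powR_ge0 _ _)); ring.
apply: lee_wpmul2l; first by rewrite lee_fin.
apply: (le_trans (cauchy_schwarz mf mg)); apply: lee_pmul; rewrite ?poweR_ge0//.
  apply: gt0_ler_poweR; rewrite ?invr_ge0//= ?in_itv/= ?leey ?andbT ?integral_ge0//.
  - by move=> z _; rewrite lee_fin sqr_ge0.
  - by move=> z _; rewrite lee_fin mulr_ge0 ?sqr_ge0 ?powR_ge0.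
  apply: ge0_le_integral => //.
  - by move=> z _; rewrite lee_fin sqr_ge0.
  - by apply/measurable_EFinP; exact: measurable_funX.
  - apply/measurable_EFinP; apply: measurable_funM; first exact: measurable_funX.
    exact: measurable_rpow2.
  move=> z _; rewrite lee_fin; have [Oz|/F0 Fz] := pselect (Om z); last first.
    by rewrite /f Fz !mul0r expr0n/= mul0r.
  rewrite rpowD; last exact: Omega2.
  by rewrite /f exprMn expr2.
apply: gt0_ler_poweR; rewrite ?invr_ge0//= ?in_itv/= ?leey ?andbT ?integral_ge0//.
- by move=> z _; rewrite lee_fin sqr_ge0.
- by move=> z _; rewrite lee_fin mulr_ge0 ?sqr_ge0 ?powR_ge0.
apply: ge0_le_integral => //.
- by move=> z _; rewrite lee_fin sqr_ge0.
- by apply/measurable_EFinP; exact: measurable_funX.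
- apply/measurable_EFinP; apply: measurable_funM; first exact: measurable_funX.
  exact: measurable_rpow2.
move=> z _; rewrite lee_fin; have [Oz|nO] := pselect (Om z); last first.
  rewrite /g /G' patch_out// mul0r expr0n/=.
  by rewrite mulr_ge0 ?sqr_ge0 ?powR_ge0.
rewrite rpowD; last exact: Omega2.
by rewrite /g /G' patch_in// exprMn expr2.
Qed.

(** A strip of width h < theta0 lies inside Omega, so its mean does not see the values outside. *)
Lemma vanishes_patch (u : R * R -> R) :
  vanishes_at_omega0 R0 u -> vanishes_at_omega0 R0 (u \_ Om).
Proof.
move=> tr a b Ra ab; have := tr a b Ra ab; rewrite /strip_mean_to0.
apply: cvg_trans; apply: near_eq_cvg; near=> h; congr (_ * _)%E.
apply: eq_integral => -[x y]; rewrite inE => -[/= + yab] /=.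
rewrite in_itv/= => /andP[x0 xh]; rewrite patch_in//; split => /=.
  rewrite in_itv/= x0/= (lt_trans xh)//; near: h; exact: nbhs_right_lt.
by move: yab; rewrite /= !in_itv/= andbT => /andP[/(lt_trans Ra)].
Unshelve. all: by end_near. Qed.

Variable u : R * R -> R.
Hypothesis twu : twice_weakly_differentiable theta0 R0 u.
Hypothesis tru : vanishes_at_omega0 R0 u.
Let d := weak_derivative theta0 R0.
Hypothesis X_fin : (norm_X theta0 R0 eps delta u < +oo)%E.
Hypothesis H_fin : (norm_H2dot theta0 R0 eps delta u < +oo)%E.

Let weak i j : (i + j <= 2)%N -> is_weak_derivative theta0 R0 i j u (d i j u).
Proof. by move=> ij; apply: weak_derivative_is; exact: twu. Qed.

Let mu0 : measurable_fun Om u.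
Proof. by case: (@weak 0 0 isT) => -[]. Qed.

Let md i j : (i + j <= 2)%N -> measurable_fun Om (d i j u).
Proof. by move=> /weak[_ []]. Qed.

Let fX z := u z ^+ 2 * r z.2 `^ delta + d 1 0 u z ^+ 2 * r z.2 `^ delta
  + d 0 1 u z ^+ 2 * r z.2 `^ (1 + delta).
Let fH z := (d 2 0 u z ^+ 2 / r z.2 ^+ 4 + d 1 1 u z ^+ 2 / r z.2 ^+ 2
  + d 0 2 u z ^+ 2) * r z.2 `^ (2 + delta).

Let mfX : measurable_fun Om fX.
Proof.
apply: measurable_funD; first apply: measurable_funD;
  apply: measurable_funM; (exact: measurable_rpow2 || apply: measurable_funX) => //;
  exact: md.
Qed.

Let mrV n : measurable_fun Om (fun z : L * L => (r z.2 ^+ n)^-1).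
Proof.
have m1 : measurable_fun Om (fun z : L * L => r z.2 `^ (- n%:R)) by exact: measurable_rpow2.
apply: eq_measurable_fun m1 => z; rewrite inE => Oz.
by rewrite powR_invn// ltW// rcoord_gt0// Omega2.
Qed.

Let mfH : measurable_fun Om fH.
Proof.
apply: measurable_funM; last exact: measurable_rpow2.
apply: measurable_funD; first apply: measurable_funD.
- by apply: measurable_funM => //; apply: measurable_funX; exact: md.
- by apply: measurable_funM => //; apply: measurable_funX; exact: md.
- by apply: measurable_funX; exact: md.
Qed.

Let U := u \_ Om.
Let W := d 0 1 u \_ Om.
Let G1 := d 1 1 u \_ Om.
Let G2 := d 0 2 u \_ Om.
Let mU : measurable_fun setT U := measurable_patch mu0.
Let mW : measurable_fun setT W := measurable_patch (@md 0 1 isT).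
Let mG1 : measurable_fun setT G1 := measurable_patch (@md 1 1 isT).
Let mG2 : measurable_fun setT G2 := measurable_patch (@md 0 2 isT).

Let intX := (\int[mu2]_(z in Om) (fX z)%:E)%E.
Let intH := (\int[mu2]_(z in Om) (fH z)%:E)%E.

Let intX_fin : (intX < +oo)%E.
Proof. by apply: lty_poweRy X_fin; rewrite invr_neq0. Qed.
Let intH_fin : (intH < +oo)%E.
Proof. by apply: lty_poweRy H_fin; rewrite invr_neq0. Qed.

Let mS (F : L * L -> R) e : measurable_fun setT F ->
  measurable_fun setT (fun z => F z ^+ 2 * r z.2 `^ e).
Proof.
by move=> mF; apply: measurable_funM; [exact: measurable_funX|exact: measurable_rpow2].
Qed.

Let S_ge0 (F : L * L -> R) e z : 0 <= F z ^+ 2 * r z.2 `^ e.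
Proof. by rewrite mulr_ge0 ?sqr_ge0 ?powR_ge0. Qed.

Let leW : (\int[mu2]_z (W z ^+ 2 * r z.2 `^ (1 + delta))%:E <= intX)%E.
Proof.
apply: le_integral_Omega => //; first exact: mS.
- by move=> z nO; rewrite /W patch_out// expr0n mul0r.
- by move=> z Oz; rewrite /W patch_in// lerDr addr_ge0.
Qed.

(** In the second-order norm the mixed derivative carries the weight r^-2 r^(2 + delta) =
    r^delta. *)
Let leG1 : (\int[mu2]_z (G1 z ^+ 2 * r z.2 `^ delta)%:E <= intH)%E.
Proof.
apply: le_integral_Omega => //; first exact: mS.
- by move=> z nO; rewrite /G1 patch_out// expr0n mul0r.
- move=> z Oz; have rz := rcoord_gt0 (Omega2 Oz).
  rewrite /G1 patch_in// /fH rpowD; last exact: Omega2.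
  rewrite (powR_mulrn 2 (ltW rz)) mulrA ler_wpM2r ?powR_ge0//.
  rewrite !mulrDl divfK ?gt_eqF ?exprn_gt0//.
  rewrite -addrA addrCA lerDl addr_ge0// mulr_ge0 ?sqr_ge0// divr_ge0 ?sqr_ge0//.
  by rewrite exprn_ge0// ltW.
Qed.

Let leG2 : (\int[mu2]_z (G2 z ^+ 2 * r z.2 `^ (2 + delta))%:E <= intH)%E.
Proof.
apply: le_integral_Omega => //; first exact: mS.
- by move=> z nO; rewrite /G2 patch_out// expr0n mul0r.
- move=> z Oz; have rz := rcoord_gt0 (Omega2 Oz).
  rewrite /G2 patch_in// /fH ler_wpM2r ?powR_ge0// lerDr.
  by rewrite addr_ge0// divr_ge0 ?sqr_ge0// exprn_ge0// ltW.
Qed.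

Let decay_sqr_le (y : R) : decay y ^+ 2 <= (1 + y ^+ 2)^-1.
Proof.
rewrite /decay exprVn lef_pV2 ?posrE ?exprn_gt0 ?ltr_wpDr ?sqr_ge0//.
have := normr_ge0 y; have := real_normK (num_real y) => <-; nra.
Qed.

(** Young's inequality gives |F| decay <= F^2 + decay^2, and r >= R0 introduces the weight r^e at
    the price of R0^-e. *)
Let young_decay (F : L * L -> R) e z : 0 <= e -> Om z ->
  `|F z| * decay z.2 <= (R0 `^ e)^-1 * (F z ^+ 2 * r z.2 `^ e) + (1 + z.2 ^+ 2)^-1.
Proof.
move=> e0 Oz; apply: (@le_trans _ _ (F z ^+ 2 + decay z.2 ^+ 2)).
  rewrite -(real_normK (num_real (F z))).
  have := sqr_ge0 (`|F z| - decay z.2).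
  have := mulr_ge0 (normr_ge0 (F z)) (ltW (decay_gt0 z.2)); nra.
apply: lerD => //; rewrite mulrCA ler_peMr ?sqr_ge0//.
by rewrite ler_pdivlMl ?powR_gt0// mulr1 rpow_ge// Omega2.
Qed.

Let iW : mu2.-integrable setT (fun z => (W z * decay z.2)%:E).
Proof.
have d0 : 0 <= 1 + delta by rewrite addr_ge0.
apply: (integrable_square_decay (C := (R0 `^ (1 + delta))^-1)
  mW (mS (1 + delta) mW) measurable_decay (S_ge0 _ _) (le_lt_trans leW intX_fin)).
- by move=> z; exact: patch_out.
- by move=> z; exact: young_decay.
- by move=> y; exact: ltW (decay_gt0 y).
- by rewrite invr_ge0 powR_ge0.
Qed.

Let iG1 : mu2.-integrable setT (fun z => (G1 z * decay z.2)%:E).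
Proof.
have d0 := delta_ge0.
apply: (integrable_square_decay (C := (R0 `^ delta)^-1)
  mG1 (mS delta mG1) measurable_decay (S_ge0 _ _) (le_lt_trans leG1 intH_fin)).
- by move=> z; exact: patch_out.
- by move=> z; exact: young_decay.
- by move=> y; exact: ltW (decay_gt0 y).
- by rewrite invr_ge0 powR_ge0.
Qed.

(** With t = 1 + R^2 one has |G2| <= G2^2 t + 1/t, and it remains to bound t by a multiple of r^2.
    This is where eps enters: r grows like sqrt(eps) R, and R <= K r with K = 1 + 1/sqrt(eps). Only
    integrability is retained, so K does not reach the final estimate. *)
Let iG2 : mu2.-integrable setT (EFin \o G2).
Proof.
have d0 := delta_ge0.
pose K : R := 1 + (Num.sqrt eps)^-1; pose C := (R0 ^- 2 + K ^+ 2) / R0 `^ delta.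
have s0 : 0 < Num.sqrt eps by rewrite sqrtr_gt0.
have C0 : 0 <= C by rewrite divr_ge0 ?powR_ge0// addr_ge0 ?sqr_ge0// invr_ge0 exprn_ge0// ltW.
suff : mu2.-integrable setT (fun z => (G2 z * cst 1 z.2)%:E).
  by apply: eq_integrable => // z _; rewrite /= mulr1.
apply: (integrable_square_decay (C := C)
  mG2 (mS (2 + delta) mG2) (measurable_cst _) (S_ge0 _ _) (le_lt_trans leG2 intH_fin)) => //.
- by move=> z; exact: patch_out.
- move=> z Oz; have Rz := Omega2 Oz; have rz := rcoord_gt0 Rz.
  have rR := rcoord_ge Rz.
  rewrite /= mulr1; set t : R := 1 + z.2 ^+ 2.
  have t0 : 0 < t by rewrite ltr_wpDr ?sqr_ge0.
  apply: (@le_trans _ _ (G2 z ^+ 2 * t + t^-1)).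
    rewrite -(ler_pM2r t0) mulrDl mulVf ?gt_eqF// -(real_normK (num_real (G2 z))).
    have := sqr_ge0 (`|G2 z| * t - 1).
    have := mulr_ge0 (normr_ge0 (G2 z)) (ltW t0); nra.
  rewrite lerD2r mulrCA ler_wpM2l ?sqr_ge0//.
  rewrite rpowD// (powR_mulrn 2 (ltW rz)).
  have tr : t <= (R0 ^- 2 + K ^+ 2) * r z.2 ^+ 2.
    rewrite mulrDl; apply: lerD.
      rewrite mulrC ler_pdivlMr ?exprn_gt0// mul1r.
      by apply: lerXn2r => //; rewrite nnegrE ltW.
    rewrite -exprMn lerXn2r ?nnegrE ?(le_trans (ltW R0_gt0) (ltW Rz))//.
      by rewrite mulr_ge0 ?(ltW rz)// addr_ge0// invr_ge0 ltW.
    rewrite /K mulrDl mul1r.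
    have -> : (Num.sqrt eps)^-1 * r z.2 = R0 / Num.sqrt eps + (z.2 - R0).
      by rewrite /r /rcoord; field; rewrite gt_eqF.
    have : 0 < R0 / Num.sqrt eps by rewrite divr_gt0.
    lra.
  apply: (le_trans tr); rewrite /C -[leRHS]mulrA ler_wpM2l//.
    by rewrite addr_ge0 ?sqr_ge0// invr_ge0 exprn_ge0// ltW.
  rewrite mulrCA ler_peMr ?exprn_ge0 ?(ltW rz)//.
  by rewrite ler_pdivlMl ?powR_gt0// mulr1 rpow_ge.
Qed.

Let UW c c' d0 d' (a b : R -> R) : 0 < c -> d0 < theta0 -> R0 < c' ->
  smooth1 a -> csupp c d0 a -> smooth1 b -> csupp c' d' b ->
  \int[mu2]_z (U z * (a z.1 * derive1 b z.2)) = - \int[mu2]_z (W z * (a z.1 * b z.2)).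
Proof.
move=> c0 dt Rc sa acd sb bcd.
have := weak_derivative_tensor (@weak 0 1 isT) c0 dt Rc sa acd sb bcd.
by rewrite Rintegral_patch Rintegral_patch expr1 mulN1r.
Qed.

Let UG1 c c' d0 d' (a b : R -> R) : 0 < c -> d0 < theta0 -> R0 < c' ->
  smooth1 a -> csupp c d0 a -> smooth1 b -> csupp c' d' b ->
  \int[mu2]_z (U z * (derive1 a z.1 * derive1 b z.2)) =
  \int[mu2]_z (G1 z * (a z.1 * b z.2)).
Proof.
move=> c0 dt Rc sa acd sb bcd.
have := weak_derivative_tensor (@weak 1 1 isT) c0 dt Rc sa acd sb bcd.
by rewrite Rintegral_patch Rintegral_patch sqrrN expr1n mul1r.
Qed.

Let UG2 c c' d0 d' (a b : R -> R) : 0 < c -> d0 < theta0 -> R0 < c' ->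
  smooth1 a -> csupp c d0 a -> smooth1 b -> csupp c' d' b ->
  \int[mu2]_z (U z * (a z.1 * derive1 (derive1 b) z.2)) =
  \int[mu2]_z (G2 z * (a z.1 * b z.2)).
Proof.
move=> c0 dt Rc sa acd sb bcd.
have := weak_derivative_tensor (@weak 0 2 isT) c0 dt Rc sa acd sb bcd.
by rewrite Rintegral_patch Rintegral_patch sqrrN expr1n mul1r.
Qed.

Let root_le (x y : \bar R) : (0 <= x -> x <= y -> x `^ 2^-1 <= y `^ 2^-1)%E.
Proof.
move=> x0 xy; apply: gt0_ler_poweR; rewrite ?invr_ge0//= ?in_itv/= ?leey ?andbT//.
exact: le_trans xy.
Qed.

Let integral_ge0_S (F : L * L -> R) e : (0 <= \int[mu2]_z (F z ^+ 2 * r z.2 `^ e)%:E)%E.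
Proof. by apply: integral_ge0 => z _; rewrite lee_fin. Qed.

Lemma norm_L4_weight_le :
  (\int[mu2]_(z in Om) (`|d 0 1 u z| ^+ 4 * r z.2 `^ (2 + 2 * delta))%:E <=
   (2%:E * (norm_X theta0 R0 eps delta u * norm_H2dot theta0 R0 eps delta u)) *
   (2%:E * (norm_X theta0 R0 eps delta u * norm_H2dot theta0 R0 eps delta u)))%E.
Proof.
(* The two exponents add up to 2 + 2 delta. Each is written as a sum of halves, so that [cs_Omega]
   yields the weights of the two norms. *)
pose p y := r y `^ ((1 + delta) / 2 + delta / 2).
pose q y := r y `^ ((1 + delta) / 2 + (2 + delta) / 2).
have q_mono y s : R0 < y -> y <= s -> q y <= q s.
  move=> Ry ys; apply: ge0_ler_powR; rewrite ?nnegrE.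
  - by rewrite addr_ge0// divr_ge0// addr_ge0.
  - exact: ltW (rcoord_gt0 Ry).
  - exact: ltW (rcoord_gt0 (lt_le_trans Ry ys)).
  - exact: rcoord_mono.
have Wo := repr_omega theta0_gt0 mU mW mG1 iW iG1.
have G10 (z : L * L) : z.1 <= 0 -> G1 z = 0.
  move=> z0; apply: patch_out => -[/=]; rewrite in_itv/= => /andP[z1 _].
  by move: (lt_le_trans z1 z0); rewrite ltxx.
have {}Wo := Wo R0 G10 (vanishes_patch tru) (fun c d0 c' d' => @UW c c' d0 d')
  (fun c d0 c' d' => @UG1 c c' d0 d').
have Wr := repr_rho mU mW mG2 iW iG2 (fun c d0 c' d' => @UW c c' d0 d')
  (fun c d0 c' d' => @UG2 c c' d0 d').
have := ladyzhenskaya mW mG1 mG2 iG1 iG2 (@patch_out _) (@patch_out _) Wo Wr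
  (measurable_rpow ((1 + delta) / 2 + delta / 2))
  (measurable_rpow ((1 + delta) / 2 + (2 + delta) / 2))
  (fun y => powR_ge0 _ _) (fun y => powR_ge0 _ _) q_mono.
have -> : (\int[mu2]_(z in Omega theta0 R0) (`|W z| ^+ 4 *
    (r z.2 `^ ((1 + delta) / 2 + delta / 2) * r z.2 `^ ((1 + delta) / 2 + (2 + delta) / 2)))%:E =
    \int[mu2]_(z in Om) (`|d 0 1 u z| ^+ 4 * r z.2 `^ (2 + 2 * delta))%:E)%E.
  apply: eq_integral => z; rewrite inE => Oz; congr EFin.
  rewrite /W patch_in// -rpowD; last exact: Omega2.
  by congr (_ * _ `^ _); lra.
move=> /le_trans; apply; apply: lee_pmul.
- by apply: integral_ge0 => z _; rewrite lee_fin !mulr_ge0 ?powR_ge0.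
- by apply: integral_ge0 => z _; rewrite lee_fin !mulr_ge0 ?powR_ge0.
- apply: (le_trans (cs_Omega _ _ mW mG1 (@patch_out _))).
  apply: lee_wpmul2l; first by rewrite lee_fin.
  by apply: lee_pmul; rewrite ?poweR_ge0// -!splitr; apply: root_le => //; exact: integral_ge0_S.
- apply: (le_trans (cs_Omega _ _ mW mG2 (@patch_out _))).
  apply: lee_wpmul2l; first by rewrite lee_fin.
  by apply: lee_pmul; rewrite ?poweR_ge0// -!splitr; apply: root_le => //; exact: integral_ge0_S.
Qed.

(** The gap e = 2 + 2 delta - kappa lies between 0 and 2. If r >= 1 then r^e >= 1; if r < 1 then r^e
    >= r^2 >= R0^2. The factor 1 + R0^-2 covers both cases. *)
Lemma rpow_weight_le kappa y : kappa <= 2 + 2 * delta -> 2 * delta <= kappa -> R0 < y ->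
  r y `^ kappa <= (1 + R0 ^- 2) * r y `^ (2 + 2 * delta).
Proof.
move=> k1 k2 Ry; have ry := rcoord_gt0 Ry; have rR := rcoord_ge Ry.
rewrite -[2 + 2 * delta](subrK kappa) rpowD// mulrA ler_peMl ?powR_ge0//.
have RV : 0 <= R0 ^- 2 by rewrite invr_ge0 exprn_ge0// ltW.
have [r1|r1] := leP 1 (r y).
  apply: mulr_ege1; first by rewrite lerDl.
  by rewrite -[leLHS](powRr0 (r y)); apply: ler_powR => //; rewrite subr_ge0.
apply: (@le_trans _ _ (R0 ^- 2 * r y ^+ 2)).
  rewrite mulrC ler_pdivlMr ?exprn_gt0// mul1r.
  by apply: lerXn2r => //; rewrite nnegrE ltW.
apply: ler_pM => //; first by rewrite exprn_ge0// ltW.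
  by rewrite lerDr.
rewrite -(powR_mulrn 2 (ltW ry)); apply: ger_powR; first by rewrite ry ltW.
lra.
Qed.

(** The fourth root of the previous bound, taken in real numbers since both norms are finite. The 4
    in the constant is the product of the two factors 2 that come from squaring a tail in each
    direction. *)
Lemma gradient_L4_le kappa : kappa <= 2 + 2 * delta -> 2 * delta <= kappa ->
  (norm_L4 theta0 R0 eps kappa (d 0 1 u) <=
   ((4 * (1 + R0 ^- 2)) `^ 4^-1)%:E * norm_X theta0 R0 eps delta u `^ 2^-1
     * norm_H2dot theta0 R0 eps delta u `^ 2^-1)%E.
Proof.
move=> k1 k2; have := norm_L4_weight_le.
have X0 : (0 <= norm_X theta0 R0 eps delta u)%E by exact: poweR_ge0.
have H0 : (0 <= norm_H2dot theta0 R0 eps delta u)%E by exact: poweR_ge0.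
have XF : norm_X theta0 R0 eps delta u \is a fin_num by rewrite ge0_fin_numE.
have HF : norm_H2dot theta0 R0 eps delta u \is a fin_num by rewrite ge0_fin_numE.
rewrite -(fineK XF) -(fineK HF).
move: (fine_ge0 X0) (fine_ge0 H0).
move: (fine (norm_X _ _ _ _ _)) (fine (norm_H2dot _ _ _ _ _)) => x h x0 h0 I4.
have C0 : 0 <= 1 + R0 ^- 2 by rewrite addr_ge0// invr_ge0 exprn_ge0// ltW.
have mw4 k : measurable_fun Om (fun z => `|d 0 1 u z| ^+ 4 * r z.2 `^ k).
  apply: measurable_funM; last exact: measurable_rpow2.
  by apply: measurable_funX; apply: measurableT_comp => //; exact: md.
have w40 k z : 0 <= `|d 0 1 u z| ^+ 4 * r z.2 `^ k by rewrite mulr_ge0 ?exprn_ge0 ?powR_ge0.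
have I4k : (\int[mu2]_(z in Om) (`|d 0 1 u z| ^+ 4 * r z.2 `^ kappa)%:E <=
    ((1 + R0 ^- 2) * (2 * (x * h)) ^+ 2)%:E)%E.
  apply: (@le_trans _ _ (\int[mu2]_(z in Om)
      ((1 + R0 ^- 2)%:E * (`|d 0 1 u z| ^+ 4 * r z.2 `^ (2 + 2 * delta))%:E))%E).
    apply: ge0_le_integral => //.
    - by move=> z _; rewrite lee_fin.
    - exact/measurable_EFinP.
    - apply: emeasurable_funM; first exact: measurable_cst.
      exact/measurable_EFinP.
    move=> z Oz; rewrite -EFinM lee_fin mulrCA ler_wpM2l ?exprn_ge0//.
    by apply: rpow_weight_le => //; exact: Omega2.
  rewrite ge0_integralZl//; last 2 first.
  - exact/measurable_EFinP.
  - by move=> z _; rewrite lee_fin.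
  by rewrite EFinM; apply: lee_wpmul2l => //; rewrite expr2 !EFinM.
apply: (@le_trans _ _ (((1 + R0 ^- 2) * (2 * (x * h)) ^+ 2)%:E `^ 4^-1)%E).
  apply: gt0_ler_poweR; rewrite ?invr_ge0//= ?in_itv/= ?leey ?andbT//.
    by apply: integral_ge0 => z _; rewrite lee_fin.
  by rewrite lee_fin mulr_ge0 ?sqr_ge0.
rewrite !poweR_EFin -!EFinM lee_fin.
have -> : (1 + R0 ^- 2) * (2 * (x * h)) ^+ 2 = 4 * (1 + R0 ^- 2) * (x ^+ 2 * h ^+ 2) by ring.
have half (t : R) : 0 <= t -> (t ^+ 2) `^ 4^-1 = t `^ 2^-1.
  move=> t0; rewrite -(powR_mulrn 2 t0) -powRrM; congr (_ `^ _).
  by field.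
rewrite powRM ?mulr_ge0 ?sqr_ge0// (powRM _ (sqr_ge0 x) (sqr_ge0 h)).
by rewrite !half// mulrA.
Qed.

End gradient_estimate.

Theorem lemma2p14 (R : realType) (theta0 R0 delta : R)
    (theta0_gt0 : 0 < theta0) (R0_gt0 : 0 < R0)
    (delta_ge : 2^-1 <= delta) (delta_le : delta <= 1) :
  exists2 delta0' : R, 0 < delta0' &
  forall delta' : R, 0 < delta' -> delta' <= delta0' ->
  let q := 1 + delta' in
  (exists2 C : R, 0 < C &
     forall (alpha eps : R) (u v P : R * R -> R),
       0 <= alpha -> alpha <= q * delta / 2 ->
       0 < eps -> eps <= 1 ->
       twice_weakly_differentiable theta0 R0 u ->
       twice_weakly_differentiable theta0 R0 v ->
       boundary_conditions theta0 R0 eps u v P ->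
       divergence_free theta0 R0 eps u v ->
       (norm_X theta0 R0 eps delta u < +oo)%E ->
       (norm_H2dot theta0 R0 eps delta u < +oo)%E ->
       (norm_X theta0 R0 eps delta v < +oo)%E ->
       (norm_H2dot theta0 R0 eps delta v < +oo)%E ->
       (norm_L4 theta0 R0 eps (2 + 2 * alpha / q)
          (weak_derivative theta0 R0 0 1 u)
        <= C%:E * (norm_X theta0 R0 eps delta u) `^ 2^-1
             * (norm_H2dot theta0 R0 eps delta u) `^ 2^-1)%E /\
       (norm_L4 theta0 R0 eps (2 + 2 * alpha / q)
          (weak_derivative theta0 R0 0 1 v)
        <= C%:E * (norm_X theta0 R0 eps delta v) `^ 2^-1
             * (norm_H2dot theta0 R0 eps delta v) `^ 2^-1)%E) /\
  (forall p : R, p^-1 + q^-1 = 1 ->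
     exists alpha : R, q / p <= alpha /\ alpha <= q * delta / 2).
Proof.
(* An admissible alpha exists as soon as delta' <= q delta / 2, and q > 1 with delta >= 1/2 makes
   the right side at least 1/4. *)
exists 4^-1; first by rewrite invr_gt0.
move=> delta' d'0 d'4 q; have q0 : 0 < q by rewrite addr_gt0.
split.
  exists ((4 * (1 + R0 ^- 2)) `^ 4^-1).
    by apply: powR_gt0; rewrite mulr_gt0// ltr_wpDr// invr_ge0 exprn_ge0// ltW.
  move=> alpha eps u v P al0 al eps0 _ twu twv [[u0 v0] _ _ _] _ Xu Hu Xv Hv.
  have aq0 : 0 <= 2 * alpha / q by rewrite divr_ge0 ?mulr_ge0// ltW.
  have aq : 2 * alpha / q <= delta.
    by rewrite ler_pdivrMr// mulrC -ler_pdivlMr// [delta * q]mulrC.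
  have k1 : 2 + 2 * alpha / q <= 2 + 2 * delta by lra.
  (* Here delta <= 1 gives 2 delta <= 2. *)
  have k2 : 2 * delta <= 2 + 2 * alpha / q by lra.
  (* Both components vanish at omega = 0, so one estimate serves for u and for v. *)
  by split; apply: gradient_L4_le.
(* The witness is the largest admissible alpha; by duality q/p = q (1 - 1/q) = q - 1 = delta'. *)
move=> p pq; exists (q * delta / 2); split => //.
have -> : q / p = delta'.
  have -> : p^-1 = 1 - q^-1 by rewrite -pq addrK.
  by rewrite mulrBr mulr1 mulfV ?gt_eqF// /q addrAC subrr add0r.
have : 1 * (2^-1) <= q * delta by apply: ler_pM => //; rewrite /q; lra.
lra.
Qed.
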